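(* Let $(M^{2n},\omega)$ be a symplectic manifold and $E\to M$ a vector bundle with a symplectically flat connection with curvature $F=\Phi\,\omega$. If $\Phi$ is invertible, then $PH^*(M,E)=0$, i.e. $PH^k_+(M,E)=0$ and $PH^k_-(M,E)=0$ for all $0\le k\le n$.
   Context: $d_A$ is the covariant exterior derivative of the connection on $\Omega^*(M,E)$ (locally $d+A\wedge$), with curvature $F\in\Omega^2(M,\mathrm{End}\,E)$. The connection is symplectically flat if there is $\Phi\in\Omega^0(M,\mathrm{End}\,E)$ with $F=\Phi\,\omega$ and $d_A\Phi=d\Phi+[A,\Phi]=0$. $\Phi$ invertible means invertible as a bundle endomorphism (at every point). $P^s(M,E)$ ($0\le s\le n$) is the space of primitive $E$-valued $s$-forms, i.e. $\beta\in\Omega^s(M,E)$ with $\omega^{n-s+1}\wedge\beta=0$. Every $\eta\in\Omega^k(M,E)$ has a unique Lefschetz decomposition $\eta=\sum_{r}\omega^r\wedge\beta_{k-2r}$ with $\beta_{k-2r}\in P^{k-2r}(M,E)$ and $\max(0,k-n)\le r\le k/2$. Set $\Pi\eta=\beta_k$ (zero if $k>n$) and $L^{-1}\eta=\sum_{r\ge1}\omega^{r-1}\wedge\beta_{k-2r}$. Define $\partial_{+A}=\Pi\,d_A:P^k(M,E)\to P^{k+1}(M,E)$ and $\partial_{-A}=L^{-1}d_A:P^k(M,E)\to P^{k-1}(M,E)$. Let $P^k_\pm(M,E)$ denote two copies of $P^k(M,E)$. The twisted primitive complex is $$0\to P^0_+\xrightarrow{\partial_{+A}}\cdots\xrightarrow{\partial_{+A}}P^n_+\xrightarrow{-\partial_{+A}\partial_{-A}+\Phi}P^n_-\xrightarrow{-\partial_{-A}}\cdots\xrightarrow{-\partial_{-A}}P^0_-\to0,$$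 and $PH^k_\pm(M,E)$ is its cohomology at $P^k_\pm(M,E)$; $PH^*(M,E)$ denotes all of these groups. *)

(* Defs.v *)
From HB Require Import structures.
From mathcomp Require Import all_boot all_order all_algebra.
From mathcomp Require Import all_classical all_reals all_analysis.
Import Order.TTheory GRing.Theory Num.Theory numFieldNormedType.Exports.

Set Implicit Arguments.
Unset Strict Implicit.
Unset Printing Implicit Defensive.

Local Open Scope classical_set_scope.
Local Open Scope ring_scope.

Fixpoint Ck_on (R : realType) (k : nat) (V W : normedModType R)
    (U : set V) (f : V -> W) : Prop :=
  match k with
  | 0%N => forall x, U x -> {for x, continuous f}
  | k'.+1 => (forall x, U x -> differentiable f x)
             /\ (forall v, Ck_on k' U (fun x => 'D_v f x))
  end.

Definition smooth_on (R : realType) (V W : normedModType R)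
    (U : set V) (f : V -> W) : Prop := forall k, Ck_on k U f.

(** ** Alternating forms on a vector space

    A form is a function of the list of its arguments.  A form of degree [k]
    vanishes on lists whose length is not [k], so that forms of all degrees
    live in one type and no degree casts are needed. *)

Definition alternating (R : realType) (T V : lmodType R) (k : nat)
    (f : seq T -> V) : Prop :=
  [/\ forall s, size s != k -> f s = 0,
      forall s1 s2 (c : R) u v,
        f (s1 ++ (c *: u + v) :: s2) = c *: f (s1 ++ u :: s2) + f (s1 ++ v :: s2)
    & forall s1 s2 s3 u, f (s1 ++ u :: s2 ++ u :: s3) = 0].

(** A mask selects the arguments fed to the left factor of a wedge product;
    [shuffle_inv m] is the number of inversions of the shuffle moving those
    arguments to the front. *)
Fixpoint shuffle_inv (m : bitseq) : nat :=
  if m is b :: m' then ((~~ b * count id m') + shuffle_inv m')%N else 0%N.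

(** Sum over shuffles; thus [dx /\ dy] evaluates to 1 on [(d/dx, d/dy)].
    The values are multiplied by [op]. *)
Definition wedge (R : realType) (T : Type) (V1 V2 : Type) (V3 : lmodType R)
    (op : V1 -> V2 -> V3) (al : seq T -> V1) (be : seq T -> V2)
    (s : seq T) : V3 :=
  \sum_(m : (size s).-tuple bool)
    (-1) ^+ shuffle_inv m *: op (al (mask m s)) (be (mask (map negb m) s)).

(** Exterior derivative of a form on (an open subset of) R^m, evaluated on
    constant vector fields:
    [(d eta)(v_0,...,v_k) = \sum_i (-1)^i D_{v_i} (eta(v_0,..,^v_i,..,v_k))]. *)
Definition ext_d (R : realType) (T V : normedModType R)
    (eta : T -> seq T -> V) (x : T) (s : seq T) : V :=
  \sum_(i < size s)
    (-1) ^+ i *: 'D_(nth 0 s i) (fun y => eta y (take i s ++ drop i.+1 s)) x.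

(** ** Manifolds and vector bundles *)

Record manifold (R : realType) (m : nat) := Manifold {
  mspace :> topologicalType;
  chart_index : Type;
  dom : chart_index -> set mspace;
  chart : chart_index -> mspace -> 'rV[R]_m;
  param : chart_index -> 'rV[R]_m -> mspace;
  manifold_hausdorff : hausdorff_space mspace;
  manifold_second_countable : @second_countable mspace;
  dom_open : forall a, open (dom a);
  dom_cover : forall p, exists a, dom a p;
  codom_open : forall a, open (chart a @` dom a);
  chartK : forall a p, dom a p -> param a (chart a p) = p;
  chart_continuous : forall a p, dom a p -> {for p, continuous (chart a)};
  param_continuous : forall a x,
    (chart a @` dom a) x -> {for x, continuous (param a)};
  transition_smooth : forall a b,
    smooth_on (chart a @` (dom a `&` dom b)) (chart b \o param a)
}.

Definition codom (R : realType) (m : nat) (M : manifold R m)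
    (a : chart_index M) : set 'rV[R]_m := chart a @` dom a.

Definition overlap (R : realType) (m : nat) (M : manifold R m)
    (a b : chart_index M) : set 'rV[R]_m := chart a @` (dom a `&` dom b).

Definition transition (R : realType) (m : nat) (M : manifold R m)
    (a b : chart_index M) : 'rV[R]_m -> 'rV[R]_m := chart b \o param a.

(** A real vector bundle of rank [r], given by its transition functions:
    [gluing a b p] maps the coordinates of a vector of the fibre at [p] in the
    trivialisation over [dom b] to its coordinates in the one over [dom a].
    The atlas of a [manifold] is an arbitrary one, not a maximal one, and
    every bundle is trivial over the charts of a suitable atlas. *)
Record vector_bundle (R : realType) (m : nat) (M : manifold R m) (r : nat) :=
  VectorBundle {
  gluing : chart_index M -> chart_index M -> M -> 'M[R]_r;
  gluing_smooth : forall a b,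
    smooth_on (overlap a b) (fun x => gluing a b (param a x));
  gluing_id : forall a p, dom a p -> gluing a a p = 1%:M;
  gluing_cocycle : forall a b c p, dom a p -> dom b p -> dom c p ->
    gluing a b p *m gluing b c p = gluing a c p
}.

(** ** Differential forms

    A differential form on [M] is the family of its expressions in the charts,
    which are functions of a point of the codomain of the chart and of a list
    of tangent vectors; it is extended by zero outside the codomain. *)

Definition forms (R : realType) (m : nat) (M : manifold R m) (V : Type) : Type :=
  chart_index M -> 'rV[R]_m -> seq 'rV[R]_m -> V.

HB.instance Definition _ (R : realType) (m : nat) (M : manifold R m)
    (V : choiceType) := Choice.copy (forms M V)
  (chart_index M -> 'rV[R]_m -> seq 'rV[R]_m -> V).
HB.instance Definition _ (R : realType) (m : nat) (M : manifold R m)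
    (V : zmodType) := GRing.Zmodule.copy (forms M V)
  (chart_index M -> 'rV[R]_m -> seq 'rV[R]_m -> V).

(** [rho a b x] converts the values from the trivialisation [b] to the
    trivialisation [a] at the point of coordinates [x] in the chart [a]. *)
Record is_form (R : realType) (m : nat) (M : manifold R m) (V : normedModType R)
    (rho : chart_index M -> chart_index M -> 'rV[R]_m -> V -> V)
    (k : nat) (eta : forms M V) : Prop := IsForm {
  form_support : forall a x s, ~ codom a x -> eta a x s = 0;
  form_alternating : forall a x, alternating k (eta a x);
  form_smooth : forall a s, smooth_on (codom a) (fun x => eta a x s);
  form_transition : forall a b x s, overlap a b x ->
    eta a x s =
    rho a b x (eta b (transition a b x)
                 [seq 'D_v (transition a b) x | v <- s])
}.

(** [k]-forms with values in R, in [E] and in [End E]. *)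
Definition is_real_form (R : realType) (m : nat) (M : manifold R m) (k : nat)
    (w : forms M R) : Prop :=
  is_form (V := R) (fun _ _ _ c => c) k w.

Definition is_E_form (R : realType) (m : nat) (M : manifold R m) (r : nat)
    (E : vector_bundle M r) (k : nat) (eta : forms M 'cV[R]_r) : Prop :=
  is_form (fun a b x y => gluing E a b (param a x) *m y) k eta.

Definition is_End_form (R : realType) (m : nat) (M : manifold R m) (r : nat)
    (E : vector_bundle M r) (k : nat) (eta : forms M 'M[R]_r) : Prop :=
  is_form (fun a b x Y =>
    gluing E a b (param a x) *m Y *m invmx (gluing E a b (param a x))) k eta.

Record symplectic (R : realType) (m : nat) (M : manifold R m)
    (w : forms M R) : Prop := Symplectic {
  symplectic_form : is_real_form 2 w;
  symplectic_closed : forall a x s, codom a x -> ext_d (w a) x s = 0;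
  symplectic_nondegenerate : forall a x u, codom a x ->
    (forall v, w a x [:: u; v] = 0) -> u = 0
}.

(** ** Connections

    A connection is given by its local connection forms: over the chart [a]
    the covariant derivative is [d + A a].  The condition on overlaps says that
    [d + A a] and [d + A b] agree on sections. *)
Record is_connection (R : realType) (m : nat) (M : manifold R m) (r : nat)
    (E : vector_bundle M r) (A : forms M 'M[R]_r) : Prop := IsConnection {
  connection_alternating : forall a x, codom a x -> alternating 1 (A a x);
  connection_smooth : forall a s, smooth_on (codom a) (fun x => A a x s);
  connection_transition : forall a b x v, overlap a b x ->
    A a x [:: v] *m gluing E a b (param a x)
      + 'D_v (fun y => gluing E a b (param a y)) x
    = gluing E a b (param a x)
      *m A b (transition a b x) [:: 'D_v (transition a b) x]
}.

(** [d A + A /\ A] *)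
Definition curvature (R : realType) (m : nat) (M : manifold R m) (r : nat)
    (A : forms M 'M[R]_r) : forms M 'M[R]_r := fun a x s =>
  ext_d (A a) x s + wedge mulmx (A a x) (A a x) s.

(** The covariant derivative [d Phi + [A, Phi]] of a section of [End E]. *)
Definition cov_End (R : realType) (m : nat) (M : manifold R m) (r : nat)
    (A Phi : forms M 'M[R]_r) : forms M 'M[R]_r := fun a x s =>
  ext_d (Phi a) x s + wedge mulmx (A a x) (Phi a x) s
    - wedge mulmx (Phi a x) (A a x) s.

Record symplectically_flat (R : realType) (m : nat) (M : manifold R m)
    (r : nat) (E : vector_bundle M r) (w : forms M R)
    (A Phi : forms M 'M[R]_r) : Prop := SymplecticallyFlat {
  flat_Phi : is_End_form E 0 Phi;
  flat_curvature : forall a x s, codom a x ->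
    curvature A a x s = wedge (fun Y c => c *: Y) (Phi a x) (w a x) s;
  flat_parallel : forall a x s, codom a x -> cov_End A Phi a x s = 0
}.

Definition invertible (R : realType) (m : nat) (M : manifold R m) (r : nat)
    (Phi : forms M 'M[R]_r) : Prop :=
  forall a x, codom a x -> Phi a x [::] \in unitmx.

(** The covariant exterior derivative of an [E]-valued form. *)
Definition dA (R : realType) (m : nat) (M : manifold R m) (r : nat)
    (A : forms M 'M[R]_r) (eta : forms M 'cV[R]_r) : forms M 'cV[R]_r :=
  fun a x s =>
  if `[< codom a x >]
  then ext_d (eta a) x s + wedge mulmx (A a x) (eta a x) s
  else 0.

Definition act_End (R : realType) (m : nat) (M : manifold R m) (r : nat)
    (Phi : forms M 'M[R]_r) (eta : forms M 'cV[R]_r) : forms M 'cV[R]_r :=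
  fun a x => wedge mulmx (Phi a x) (eta a x).

(** ** The Lefschetz decomposition *)

Definition lef (R : realType) (m : nat) (M : manifold R m) (r : nat)
    (w : forms M R) (eta : forms M 'cV[R]_r) : forms M 'cV[R]_r :=
  fun a x => wedge *:%R (w a x) (eta a x).

Definition primitive (R : realType) (n : nat) (M : manifold R n.*2) (r : nat)
    (E : vector_bundle M r) (w : forms M R) (k : nat)
    (beta : forms M 'cV[R]_r) : Prop :=
  [/\ (k <= n)%N, is_E_form E k beta & iter (n - k).+1 (lef w) beta = 0].

(** [beta i] is the primitive form of degree [k - 2i] in the decomposition of
    [eta]; the truncated difference [k - n] is [max(0, k - n)]. *)
Definition lefschetz_decomposition (R : realType) (n : nat)
    (M : manifold R n.*2) (r : nat) (E : vector_bundle M r) (w : forms M R)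
    (k : nat) (eta : forms M 'cV[R]_r) (beta : nat -> forms M 'cV[R]_r) : Prop :=
  [/\ forall i, (k - n <= i <= k./2)%N -> primitive E w (k - i.*2) (beta i),
      forall i, ~~ (k - n <= i <= k./2)%N -> beta i = 0
    & eta = \sum_(i < k./2.+1) iter i (lef w) (beta i)].

Definition lefschetz (R : realType) (n : nat) (M : manifold R n.*2) (r : nat)
    (E : vector_bundle M r) (w : forms M R) (k : nat) (eta : forms M 'cV[R]_r)
    : nat -> forms M 'cV[R]_r :=
  xget (fun=> 0) [set beta | lefschetz_decomposition E w k eta beta].

(** [Pi] and [L^{-1}] on forms of degree [k]. *)
Definition prim_proj (R : realType) (n : nat) (M : manifold R n.*2) (r : nat)
    (E : vector_bundle M r) (w : forms M R) (k : nat) (eta : forms M 'cV[R]_r)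
    : forms M 'cV[R]_r := lefschetz E w k eta 0.

Definition lef_inv (R : realType) (n : nat) (M : manifold R n.*2) (r : nat)
    (E : vector_bundle M r) (w : forms M R) (k : nat) (eta : forms M 'cV[R]_r)
    : forms M 'cV[R]_r :=
  \sum_(1 <= i < k./2.+1) iter i.-1 (lef w) (lefschetz E w k eta i).

(** ** The twisted primitive complex *)

Definition partial_plus (R : realType) (n : nat) (M : manifold R n.*2) (r : nat)
    (E : vector_bundle M r) (w : forms M R) (A : forms M 'M[R]_r) (k : nat)
    (beta : forms M 'cV[R]_r) : forms M 'cV[R]_r :=
  prim_proj E w k.+1 (dA A beta).

Definition partial_minus (R : realType) (n : nat) (M : manifold R n.*2)
    (r : nat) (E : vector_bundle M r) (w : forms M R) (A : forms M 'M[R]_r)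
    (k : nat) (beta : forms M 'cV[R]_r) : forms M 'cV[R]_r :=
  lef_inv E w k.+1 (dA A beta).

(** The complex has [2n + 2] terms, numbered from [0] to [2n + 1]: the term
    [j <= n] is [P^j_+] and the term [2n + 1 - k], for [k <= n], is [P^k_-]. *)
Definition prim_degree (n j : nat) : nat :=
  if (j <= n)%N then j else (n.*2.+1 - j)%N.

Definition prim_space (R : realType) (n : nat) (M : manifold R n.*2) (r : nat)
    (E : vector_bundle M r) (w : forms M R) (j : nat)
    : set (forms M 'cV[R]_r) :=
  [set beta | primitive E w (prim_degree n j) beta].

(** At the last term, [j = 2n + 1], this is the zero map, since [lef_inv]
    vanishes on forms of degree 1. *)
Definition prim_diff (R : realType) (n : nat) (M : manifold R n.*2) (r : nat)
    (E : vector_bundle M r) (w : forms M R) (A Phi : forms M 'M[R]_r) (j : nat)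
    (beta : forms M 'cV[R]_r) : forms M 'cV[R]_r :=
  if (j < n)%N then partial_plus E w A j beta
  else if j == n then
    - partial_plus E w A n.-1 (partial_minus E w A n beta) + act_End Phi beta
  else - partial_minus E w A (prim_degree n j) beta.

Definition prim_cocycles (R : realType) (n : nat) (M : manifold R n.*2)
    (r : nat) (E : vector_bundle M r) (w : forms M R) (A Phi : forms M 'M[R]_r)
    (j : nat) : set (forms M 'cV[R]_r) :=
  [set beta | prim_space E w j beta /\ prim_diff E w A Phi j beta = 0].

Definition prim_coboundaries (R : realType) (n : nat) (M : manifold R n.*2)
    (r : nat) (E : vector_bundle M r) (w : forms M R) (A Phi : forms M 'M[R]_r)
    (j : nat) : set (forms M 'cV[R]_r) :=
  if j is i.+1 then prim_diff E w A Phi i @` prim_space E w i else [set 0].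

Definition prim_class (R : realType) (n : nat) (M : manifold R n.*2)
    (r : nat) (E : vector_bundle M r) (w : forms M R) (A Phi : forms M 'M[R]_r)
    (j : nat) (beta : forms M 'cV[R]_r) : set (forms M 'cV[R]_r) :=
  [set beta' | prim_cocycles E w A Phi j beta'
               /\ prim_coboundaries E w A Phi j (beta' - beta)].

(** The cohomology at the term [j], as the set of the cohomology classes. *)
Definition prim_cohomology (R : realType) (n : nat) (M : manifold R n.*2)
    (r : nat) (E : vector_bundle M r) (w : forms M R) (A Phi : forms M 'M[R]_r)
    (j : nat) : set (set (forms M 'cV[R]_r)) :=
  prim_class E w A Phi j @` prim_cocycles E w A Phi j.

Definition PH_plus (R : realType) (n : nat) (M : manifold R n.*2)
    (r : nat) (E : vector_bundle M r) (w : forms M R) (A Phi : forms M 'M[R]_r)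
    (k : nat) := prim_cohomology E w A Phi k.

Definition PH_minus (R : realType) (n : nat) (M : manifold R n.*2)
    (r : nat) (E : vector_bundle M r) (w : forms M R) (A Phi : forms M 'M[R]_r)
    (k : nat) := prim_cohomology E w A Phi (n.*2.+1 - k).

(* Main.v *)
(** For a primitive [k]-form [beta], [k <= n], the form [L^(n-k+1) d_A beta]
    vanishes, so [d_A beta = partial_+ beta + L (partial_- beta)].  Since
    [d_A^2 = Phi L] and [d_A] commutes with [L] and [Phi], the map
    [Phi^-1 partial_-] contracts the positive half: if [partial_+ beta = 0] then
    [Phi L beta = L d_A (partial_- beta)], and [L] is injective below the middle
    degree, so [beta = d_A (Phi^-1 partial_- beta)].  Similarly
    [- Phi^-1 partial_+] contracts the negative half, and [Phi^-1] itself inverts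
    the middle map on the kernel of [partial_-].

    Existence, smoothness and naturality of the two-term decomposition come from
    contraction with [- 1/2 omega^-1], which together with [L] satisfies the sl2
    relation [[Lam, L] = n - k] on [k]-forms. *)
From HB Require Import structures.
From mathcomp Require Import all_boot all_order all_algebra.
From mathcomp Require Import all_classical all_reals all_analysis.
From mathcomp Require Import ring zify.
Require Import Defs.
Import Order.TTheory GRing.Theory Num.Theory numFieldNormedType.Exports.

Set Implicit Arguments.
Unset Strict Implicit.
Unset Printing Implicit Defensive.

Local Open Scope classical_set_scope.
Local Open Scope ring_scope.

(** Forms are families of chart expressions, so the algebra rests on an analytic fact: that [dA]
    sends E-forms to E-forms amounts to naturality of the exterior derivative under transition maps,
    which in turn needs the symmetry of second derivatives. [wedge] is a sum over shuffles, but most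
    of its identities are reached through [wedge_cons]: an argument fed to the right factor passes
    every later argument fed to the left one, so the interior product is an antiderivation. Together
    with Cartan's formula [ext_d_cons] for constant vectors, this turns identities between forms
    into inductions on the list of arguments. [prim_proj] and [lef_inv] are read off a decomposition
    picked by choice, so neither their values nor their additivity is visible from the definition.
    Uniqueness of the Lefschetz decomposition lets any exhibited splitting compute them; additivity
    and commutation with [Phi^-1] then come from operations on splittings. *)

Definition contract (T V : Type) (v : T) (f : seq T -> V) : seq T -> V :=
  fun s => f (v :: s).

(** The main involution of the graded algebra: the sign in every antiderivation rule below. *)
Definition grade_inv (R : realType) (T : Type) (V : lmodType R)
  (f : seq T -> V) : seq T -> V := fun s => (-1) ^+ size s *: f s.

(** A predicate on a bare function, so that [mulmx] of any sizes, [*:%R] and its flip share one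
    theory of [wedge]. *)
Definition bilin (R : realType) (V1 V2 V3 : lmodType R) (op : V1 -> V2 -> V3) :=
  (forall c u v w, op (c *: u + v) w = c *: op u w + op v w) /\
  (forall c u v w, op w (c *: u + v) = c *: op w u + op w v).

Section bilinear_maps.
Context (R : realType) (V1 V2 V3 : lmodType R) (op : V1 -> V2 -> V3).
Hypothesis hop : bilin op.

Lemma bilin0l w : op 0 w = 0.
Proof.
apply: (addrI (op 0 w)).
by have := hop.1 1 0 0 w; rewrite !scale1r addr0 => <-; rewrite addr0.
Qed.

Lemma bilin0r w : op w 0 = 0.
Proof.
apply: (addrI (op w 0)).
by have := hop.2 1 0 0 w; rewrite !scale1r addr0 => <-; rewrite addr0.
Qed.

Lemma bilinDl u v w : op (u + v) w = op u w + op v w.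
Proof. by have := hop.1 1 u v w; rewrite !scale1r. Qed.

Lemma bilinDr u v w : op w (u + v) = op w u + op w v.
Proof. by have := hop.2 1 u v w; rewrite !scale1r. Qed.

Lemma bilinZl c u w : op (c *: u) w = c *: op u w.
Proof. by have := hop.1 c u 0 w; rewrite bilin0l !addr0. Qed.

Lemma bilinZr c u w : op w (c *: u) = c *: op w u.
Proof. by have := hop.2 c u 0 w; rewrite bilin0r !addr0. Qed.

End bilinear_maps.

Lemma bilin_mulmx (R : realType) p q r :
  @bilin R 'M[R]_(p, q) 'M[R]_(q, r) 'M[R]_(p, r) mulmx.
Proof.
split=> c u v w; first by rewrite mulmxDl scalemxAl.
by rewrite mulmxDr scalemxAr.
Qed.

Lemma bilin_scale (R : realType) (V : lmodType R) :
  @bilin R R^o V V *:%R.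
Proof.
split=> c u v w; first by rewrite scalerDl scalerA.
by rewrite scalerDr !scalerA mulrC.
Qed.

Lemma bilin_scaler (R : realType) (V : lmodType R) :
  @bilin R V R^o V (fun v c => c *: v).
Proof.
split=> c u v w; first by rewrite scalerDr !scalerA mulrC.
by rewrite scalerDl scalerA.
Qed.

(** * Interior products and the shuffle sum *)

(** Separates the shuffles by the factor that receives the first argument. *)
Lemma big_cons_tuple (V : zmodType) n (F : seq bool -> V) :
  \sum_(m : n.+1.-tuple bool) F m
  = \sum_(m : n.-tuple bool) F (true :: m)
    + \sum_(m : n.-tuple bool) F (false :: m).
Proof.
rewrite (reindex (fun p : bool * n.-tuple bool => [tuple of p.1 :: p.2])) /=.
  rewrite -(pair_bigA _ (fun b (m : n.-tuple bool) => F (b :: m))) /=.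
  by rewrite big_bool.
exists (fun t : n.+1.-tuple bool => (thead t, [tuple of behead t])).
  by move=> [b m] _ /=; congr (_, _); apply/val_inj.
by move=> t _; apply/val_inj; rewrite [in RHS](tuple_eta t).
Qed.

Section wedge_cons.
Context (R : realType) (T : Type) (V1 V2 V3 : lmodType R) (op : V1 -> V2 -> V3).
Hypothesis hop : bilin op.
Implicit Types (al : seq T -> V1) (be : seq T -> V2).

Lemma wedge_nil al be : wedge op al be [::] = op (al [::]) (be [::]).
Proof.
rewrite /wedge /= (big_pred1 [tuple]) /=; last by move=> t; rewrite (tuple0 t); apply/esym/eqP.
by rewrite /= scale1r.
Qed.

(* The grading involution carries the Leibniz sign, so that no degree
   hypothesis is needed. *)
Lemma wedge_cons al be v s :
  wedge op al be (v :: s)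
  = wedge op (contract v al) be s + wedge op (grade_inv al) (contract v be) s.
Proof.
rewrite /wedge /=.
rewrite (big_cons_tuple _ (fun m => (-1) ^+ shuffle_inv m
  *: op (al (mask m (v :: s))) (be (mask (map negb m) (v :: s))))).
congr (_ + _); apply: eq_bigr => m _ /=.
rewrite mul1n /grade_inv size_mask ?size_tuple //.
by rewrite (bilinZl hop) scalerA -exprD addnC.
Qed.

Lemma wedge0l be : wedge op (fun=> 0) be = fun=> 0.
Proof.
by apply/funext => s; rewrite /wedge big1 // => m _; rewrite (bilin0l hop) scaler0.
Qed.

Lemma wedge0r al : wedge op al (fun=> 0) = fun=> 0.
Proof.
by apply/funext => s; rewrite /wedge big1 // => m _; rewrite (bilin0r hop) scaler0.
Qed.

Lemma wedge_linl c al al' be s :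
  wedge op (fun s => c *: al s + al' s) be s = c *: wedge op al be s + wedge op al' be s.
Proof.
rewrite /wedge scaler_sumr -big_split; apply: eq_bigr => m _ /=.
by rewrite hop.1 scalerDr !scalerA mulrC.
Qed.

Lemma wedge_linr c al be be' s :
  wedge op al (fun s => c *: be s + be' s) s = c *: wedge op al be s + wedge op al be' s.
Proof.
rewrite /wedge scaler_sumr -big_split; apply: eq_bigr => m _ /=.
by rewrite hop.2 scalerDr !scalerA mulrC.
Qed.

Lemma wedgeDl al al' be s :
  wedge op (fun s => al s + al' s) be s = wedge op al be s + wedge op al' be s.
Proof.
by rewrite -[X in X + _]scale1r -wedge_linl; congr wedge; apply/funext => t; rewrite scale1r.
Qed.

Lemma wedgeDr al be be' s :
  wedge op al (fun s => be s + be' s) s = wedge op al be s + wedge op al be' s.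
Proof.
by rewrite -[X in X + _]scale1r -wedge_linr; congr wedge; apply/funext => t; rewrite scale1r.
Qed.

Lemma wedgeZl c al be s :
  wedge op (fun s => c *: al s) be s = c *: wedge op al be s.
Proof.
rewrite /wedge scaler_sumr; apply: eq_bigr => m _ /=.
by rewrite (bilinZl hop) !scalerA mulrC.
Qed.

Lemma wedgeZr c al be s :
  wedge op al (fun s => c *: be s) s = c *: wedge op al be s.
Proof.
rewrite /wedge scaler_sumr; apply: eq_bigr => m _ /=.
by rewrite (bilinZr hop) !scalerA mulrC.
Qed.

Lemma wedge_suml (I : Type) (r : seq I) (F : I -> seq T -> V1) be s :
  wedge op (fun s => \sum_(i <- r) F i s) be s = \sum_(i <- r) wedge op (F i) be s.
Proof.
rewrite /wedge exchange_big /=; apply: eq_bigr => m _; rewrite -scaler_sumr; congr (_ *: _).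
elim: r => [|i r IH]; first by rewrite !big_nil (bilin0l hop).
by rewrite !big_cons (bilinDl hop) IH.
Qed.

Lemma wedge_sumr (I : Type) (r : seq I) al (F : I -> seq T -> V2) s :
  wedge op al (fun s => \sum_(i <- r) F i s) s = \sum_(i <- r) wedge op al (F i) s.
Proof.
rewrite /wedge exchange_big /=; apply: eq_bigr => m _; rewrite -scaler_sumr; congr (_ *: _).
elim: r => [|i r IH]; first by rewrite !big_nil (bilin0r hop).
by rewrite !big_cons (bilinDr hop) IH.
Qed.

(** The recursion closes at once: contractions of [al] vanish and the grading involution fixes
    it. *)
Lemma wedge_deg0 al be s : (forall s, size s != 0%N -> al s = 0) ->
  wedge op al be s = op (al [::]) (be s).
Proof.
move=> al0; have e : grade_inv al = al.
  apply/funext => -[|u t]; rewrite /grade_inv ?expr0 ?scale1r //.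
  by rewrite [al _]al0 // scaler0.
elim: s be => [|v s IH] be; first exact: wedge_nil.
rewrite wedge_cons e IH.
have -> : contract v al = fun=> 0 by apply/funext => t; rewrite /contract al0.
by rewrite wedge0l add0r.
Qed.

Lemma wedge_hom p q al be : (forall s, size s != p -> al s = 0) ->
  (forall s, size s != q -> be s = 0) ->
  forall s, size s != (p + q)%N -> wedge op al be s = 0.
Proof.
move=> hal hbe s hs; rewrite /wedge big1 // => m _.
have [hp|hp] := eqVneq (count id m) p; last first.
  by rewrite hal ?(bilin0l hop) ?scaler0 // size_mask // size_tuple.
rewrite hbe ?(bilin0r hop) ?scaler0 // size_mask ?size_map ?size_tuple //.
apply: contra hs => /eqP <-; rewrite -hp count_map.
by rewrite -[X in X == _](size_tuple m) -(count_predC id m).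
Qed.

Lemma contract_grade_inv (V : lmodType R) v (al : seq T -> V) :
  contract v (grade_inv al) = fun s => - grade_inv (contract v al) s.
Proof.
apply/funext => s; rewrite /contract /grade_inv /= exprS mulN1r scaleNr.
by [].
Qed.

Lemma grade_inv_wedge al be :
  grade_inv (wedge op al be) = wedge op (grade_inv al) (grade_inv be).
Proof.
apply/funext => s; rewrite /grade_inv /wedge scaler_sumr; apply: eq_bigr => m _.
have e : size s = (size (mask m s) + size (mask [seq ~~ b | b <- m] s))%N.
  rewrite !size_mask ?size_map ?size_tuple // count_map.
  by rewrite -[LHS](size_tuple m) -(count_predC id m).
rewrite (bilinZl hop) (bilinZr hop) !scalerA -!exprD.
by congr (_ ^+ _ *: _); rewrite -e addnC.
Qed.

End wedge_cons.

Lemma wedge_map (R : realType) (T T' : Type) (V1 V2 V3 : lmodType R)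
  (op : V1 -> V2 -> V3) (al : seq T' -> V1) (be : seq T' -> V2) (J : T -> T') s :
  wedge op al be (map J s) = wedge op (fun s => al (map J s)) (fun s => be (map J s)) s.
Proof.
rewrite /wedge; move: (size_map J s); move: (size (map J s)) => n e.
by subst n; apply: eq_bigr => m _; rewrite !map_mask.
Qed.

Lemma wedge_morph (R : realType) (T : Type) (V1 V2 V3 W1 W2 W3 : lmodType R)
  (op : V1 -> V2 -> V3) (op' : W1 -> W2 -> W3) (g1 : V1 -> W1) (g2 : V2 -> W2)
  (g : {linear V3 -> W3}) (al : seq T -> V1) (be : seq T -> V2) s :
  (forall u v, g (op u v) = op' (g1 u) (g2 v)) ->
  g (wedge op al be s) = wedge op' (fun s => g1 (al s)) (fun s => g2 (be s)) s.
Proof.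
move=> h; rewrite /wedge linear_sum; apply: eq_bigr => m _.
by rewrite linearZ h.
Qed.

(** Both sides obey the same recursion on the first argument, which avoids shuffles into three
    blocks. The four products are independent, so that scalars, endomorphisms and sections can be
    mixed. *)
Lemma wedgeA (R : realType) (T : Type) (V1 V2 V3 V12 V23 W : lmodType R)
  (op12 : V1 -> V2 -> V12) (opl : V12 -> V3 -> W)
  (op23 : V2 -> V3 -> V23) (opr : V1 -> V23 -> W)
  (al : seq T -> V1) (be : seq T -> V2) (ga : seq T -> V3) s :
  bilin op12 -> bilin opl -> bilin op23 -> bilin opr ->
  (forall a b c, opl (op12 a b) c = opr a (op23 b c)) ->
  wedge opl (wedge op12 al be) ga s = wedge opr al (wedge op23 be ga) s.
Proof.
move=> h12 hl h23 hr h; elim: s al be ga => [|v s IH] al be ga.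
  by rewrite !wedge_nil h.
rewrite !wedge_cons //.
have -> : contract v (wedge op12 al be) = fun s =>
    wedge op12 (contract v al) be s + wedge op12 (grade_inv al) (contract v be) s.
  by apply/funext => t; rewrite /contract wedge_cons.
have -> : contract v (wedge op23 be ga) = fun s =>
    wedge op23 (contract v be) ga s + wedge op23 (grade_inv be) (contract v ga) s.
  by apply/funext => t; rewrite /contract wedge_cons.
by rewrite wedgeDl // wedgeDr // !IH grade_inv_wedge // IH addrA.
Qed.

(** Signs depend on the parity only, and parity, unlike degree, survives every contraction: a
    contracted 0-form would have degree -1. *)
Definition has_parity (R : realType) (T : Type) (V : lmodType R) (p : bool)
  (al : seq T -> V) := forall s, odd (size s) != p -> al s = 0.

Lemma has_parity_contract (R : realType) (T : Type) (V : lmodType R) p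
  (al : seq T -> V) v : has_parity p al -> has_parity (~~ p) (contract v al).
Proof. by move=> h s hs; rewrite /contract h //=; case: odd p hs {h} => -[]. Qed.

Lemma grade_inv_parity (R : realType) (T : Type) (V : lmodType R) p
  (al : seq T -> V) : has_parity p al -> grade_inv al = fun s => (-1) ^+ p *: al s.
Proof.
move=> h; apply/funext => s; rewrite /grade_inv.
have [<-|hp] := eqVneq (odd (size s)) p; first by rewrite signr_odd.
by rewrite h // !scaler0.
Qed.

(** Contraction flips the parity of one factor, so the induction runs over all parities at once. *)
Lemma wedgeC (R : realType) (T : Type) (V1 V2 W : lmodType R)
  (op : V1 -> V2 -> W) (op' : V2 -> V1 -> W) p q
  (al : seq T -> V1) (be : seq T -> V2) s :
  bilin op -> bilin op' -> (forall a b, op a b = op' b a) ->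
  has_parity p al -> has_parity q be ->
  wedge op al be s = (-1) ^+ (p && q) *: wedge op' be al s.
Proof.
move=> h h' hC; elim: s p q al be => [|v s IH] p q al be hp hq.
  rewrite !wedge_nil hC; case: p hp => hp; last by rewrite scale1r.
  by rewrite hp // (bilin0r h') scaler0.
rewrite !wedge_cons // (grade_inv_parity hp) (grade_inv_parity hq) !wedgeZl //.
rewrite (IH _ _ _ _ (has_parity_contract v hp) hq).
rewrite (IH _ _ _ _ hp (has_parity_contract v hq)).
rewrite !scalerDr !scalerA addrC; congr (_ *: _ + _ *: _).
  by case: p q {hp hq} => -[]; rewrite /= ?expr0 ?expr1 ?mulr1 ?mul1r ?mulrNN ?mulr1.
by case: p q {hp hq} => -[]; rewrite /= ?expr0 ?expr1 ?mulr1 ?mul1r ?mulrNN ?mulr1.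
Qed.

(** * Multilinear and alternating functions of lists *)

Definition slot_linear (R : realType) (T V : lmodType R) (f : seq T -> V) :=
  forall s1 s2 (c : R) u v,
    f (s1 ++ (c *: u + v) :: s2) = c *: f (s1 ++ u :: s2) + f (s1 ++ v :: s2).

Definition adjacent_vanish (R : realType) (T V : lmodType R) (f : seq T -> V) :=
  forall s1 s2 u, f (s1 ++ u :: u :: s2) = 0.

Section alternating.
Context (R : realType) (T V : lmodType R).
Implicit Types f g : seq T -> V.

(** Polarisation of the vanishing on two adjacent copies of [u + v]. *)
Lemma swap_adjacent f s1 s2 u v : slot_linear f -> adjacent_vanish f ->
  f (s1 ++ u :: v :: s2) = - f (s1 ++ v :: u :: s2).
Proof.
move=> hl ha; apply/eqP; rewrite -addr_eq0; apply/eqP.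
have := ha s1 s2 (u + v).
have hl1 s s' a b : f (s ++ (a + b) :: s') = f (s ++ a :: s') + f (s ++ b :: s').
  by have := hl s s' 1 a b; rewrite !scale1r.
rewrite hl1.
have := hl1 (s1 ++ [:: u]) s2 u v; have := hl1 (s1 ++ [:: v]) s2 u v.
by rewrite -!catA /= => -> ->; rewrite !ha add0r addr0.
Qed.

(** Swaps bring equal arguments next to each other. The adjacent condition is the convenient one for
    inductions that strip the first argument. *)
Lemma alternatingP k f : (forall s, size s != k -> f s = 0) ->
  slot_linear f -> adjacent_vanish f -> alternating k f.
Proof.
move=> hk hl ha; split=> // s1 s2 s3 u; elim: s2 s1 => [|w s2 IH] s1 //=.
rewrite swap_adjacent //.
by have := IH (s1 ++ [:: w]); rewrite -catA /= => ->; rewrite oppr0.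
Qed.

Lemma alternating_hom k f : alternating k f -> forall s, size s != k -> f s = 0.
Proof. by case. Qed.

Lemma alternating_linear k f : alternating k f -> slot_linear f.
Proof. by case. Qed.

Lemma alternating_adjacent k f : alternating k f -> adjacent_vanish f.
Proof. by case=> _ _ h s1 s2 u; exact: (h s1 [::] s2 u). Qed.

Lemma alternating_parity k f : alternating k f -> has_parity (odd k) f.
Proof. by case=> h _ _ s hs; apply: h; apply: contra hs => /eqP ->. Qed.

Lemma alternating0 k : alternating k (fun _ : seq T => 0 : V).
Proof. by split=> // *; rewrite scaler0 addr0. Qed.

Lemma alternating_lin k c f g : alternating k f -> alternating k g ->
  alternating k (fun s => c *: f s + g s).
Proof.
move=> [f1 f2 f3] [g1 g2 g3]; split.
- by move=> s hs; rewrite f1 // g1 // scaler0 addr0.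
- move=> s1 s2 d u v; rewrite f2 g2 !scalerDr addrACA !scalerA.
  by rewrite (mulrC c).
- by move=> s1 s2 s3 u; rewrite f3 g3 scaler0 addr0.
Qed.

Lemma slot_linear_contract f v : slot_linear f -> slot_linear (contract v f).
Proof. by move=> h s1 s2 c a b; exact: (h (v :: s1)). Qed.

Lemma adjacent_vanish_contract f v : adjacent_vanish f -> adjacent_vanish (contract v f).
Proof. by move=> h s1 s2 u; exact: (h (v :: s1)). Qed.

Lemma alternating_contract k f v : alternating k f -> alternating k.-1 (contract v f).
Proof.
case=> h1 h2 h3; split.
- move=> s hs; apply: h1 => /=; case: k hs => // k /=.
- by move=> s1 s2; exact: (h2 (v :: s1)).
- by move=> s1; exact: (h3 (v :: s1)).
Qed.

Lemma slot_linear_cons f (c : R) u v s : slot_linear f ->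
  f (c *: u + v :: s) = c *: f (u :: s) + f (v :: s).
Proof. by move=> /(_ [::] s c u v). Qed.

Lemma slot_linear_sum f n (c : 'I_n -> R) (u : 'I_n -> T) s : slot_linear f ->
  f (\sum_i c i *: u i :: s) = \sum_i c i *: f (u i :: s).
Proof.
move=> h; elim: (index_enum _) => [|i l IH]; rewrite ?big_nil ?big_cons.
  by have := slot_linear_cons (-1) (0 : T) 0 s h; rewrite scaler0 addr0 scaleN1r addNr.
by rewrite slot_linear_cons // IH.
Qed.

Lemma slot_linear_grade_inv f : slot_linear f -> slot_linear (grade_inv f).
Proof.
move=> h s1 s2 c u v; rewrite /grade_inv !size_cat /= h scalerDr !scalerA.
by rewrite mulrC.
Qed.

Lemma adjacent_vanish_grade_inv f : adjacent_vanish f -> adjacent_vanish (grade_inv f).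
Proof. by move=> h s1 s2 u; rewrite /grade_inv h scaler0. Qed.

End alternating.

Section alternating_wedge.
Context (R : realType) (T V1 V2 V3 : lmodType R) (op : V1 -> V2 -> V3).
Hypothesis hop : bilin op.

Lemma slot_linear_wedge (al : seq T -> V1) (be : seq T -> V2) :
  slot_linear al -> slot_linear be -> slot_linear (wedge op al be).
Proof.
move=> hal hbe s1; elim: s1 al be hal hbe => [|w s1 IH] al be hal hbe s2 c u v /=.
  rewrite !wedge_cons //.
  have -> : contract (c *: u + v) al = fun s => c *: contract u al s + contract v al s.
    by apply/funext => s; rewrite /contract slot_linear_cons.
  have -> : contract (c *: u + v) be = fun s => c *: contract u be s + contract v be s.
    by apply/funext => s; rewrite /contract slot_linear_cons.
  by rewrite wedge_linl // wedge_linr // scalerDr addrACA.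
rewrite !wedge_cons //.
rewrite !IH ?scalerDr; try by [exact: slot_linear_contract|exact: slot_linear_grade_inv|].
by rewrite addrACA.
Qed.

Lemma adjacent_vanish_wedge (al : seq T -> V1) (be : seq T -> V2) :
  adjacent_vanish al -> adjacent_vanish be -> adjacent_vanish (wedge op al be).
Proof.
move=> hal hbe s1; elim: s1 al be hal hbe => [|w s1 IH] al be hal hbe s2 u /=.
  rewrite !wedge_cons //.
  have -> : contract u (contract u al) = fun=> 0.
    by apply/funext => s; exact: (hal [::]).
  have -> : contract u (contract u be) = fun=> 0.
    by apply/funext => s; exact: (hbe [::]).
  (* Only the two cross terms are left, and [contract_grade_inv] gives them opposite signs. *)
  rewrite wedge0l // wedge0r // add0r addr0 contract_grade_inv.
  rewrite -[X in wedge op (fun s => - X s)]/(grade_inv (contract u al)).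
  have -> : (fun s => - grade_inv (contract u al) s)
     = (fun s => (-1) *: grade_inv (contract u al) s).
    by apply/funext => s; rewrite scaleN1r.
  by rewrite wedgeZl // scaleN1r subrr.
rewrite !wedge_cons // !IH ?addr0 //.
- exact: adjacent_vanish_grade_inv.
- exact: adjacent_vanish_contract.
- exact: adjacent_vanish_contract.
Qed.

Lemma alternating_wedge p q (al : seq T -> V1) (be : seq T -> V2) :
  alternating p al -> alternating q be -> alternating (p + q) (wedge op al be).
Proof.
move=> hal hbe; apply: alternatingP.
- exact: wedge_hom hop _ _ _ _ (alternating_hom hal) (alternating_hom hbe).
- exact: slot_linear_wedge (alternating_linear hal) (alternating_linear hbe).
- exact: adjacent_vanish_wedge (alternating_adjacent hal) (alternating_adjacent hbe).
Qed.

End alternating_wedge.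

(** * Lefschetz decomposition from the sl2 relation *)

Section sl2.
Context (R : realType) (X : lmodType R) (n : nat).
Context (D : nat -> X -> Prop) (L Lam : X -> X).
Hypothesis Dlin : forall k c x y, D k x -> D k y -> D k (c *: x + y).
Hypothesis DL : forall k x, D k x -> D k.+2 (L x).
Hypothesis DLam : forall k x, D k.+2 x -> D k (Lam x).
Hypothesis Lam0 : forall x, D 0%N x -> Lam x = 0.
Hypothesis Lam1 : forall x, D 1%N x -> Lam x = 0.
Hypothesis Llin : forall c x y, L (c *: x + y) = c *: L x + L y.
Hypothesis Lamlin : forall c x y, Lam (c *: x + y) = c *: Lam x + Lam y.
Hypothesis LamL : forall k x, D k x -> Lam (L x) = L (Lam x) + (n%:R - k%:R) *: x.

Lemma lef0 : L 0 = 0.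
Proof. by have := Llin (-1) 0 0; rewrite scaler0 addr0 scaleN1r addNr. Qed.

Lemma lefZ c x : L (c *: x) = c *: L x.
Proof. by have := Llin c x 0; rewrite lef0 !addr0. Qed.

Lemma lefD x y : L (x + y) = L x + L y.
Proof. by have := Llin 1 x y; rewrite !scale1r. Qed.

Lemma Lam_0 : Lam 0 = 0.
Proof. by have := Lamlin (-1) 0 0; rewrite scaler0 addr0 scaleN1r addNr. Qed.

Lemma LamZ c x : Lam (c *: x) = c *: Lam x.
Proof. by have := Lamlin c x 0; rewrite Lam_0 !addr0. Qed.

Lemma LamD x y : Lam (x + y) = Lam x + Lam y.
Proof. by have := Lamlin 1 x y; rewrite !scale1r. Qed.

Lemma iter_lef0 m : iter m L 0 = 0.
Proof. by elim: m => //= m ->; exact: lef0. Qed.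

Lemma iter_lefD m x y : iter m L (x + y) = iter m L x + iter m L y.
Proof. by elim: m => //= m ->; exact: lefD. Qed.

Lemma iter_lefZ m c x : iter m L (c *: x) = c *: iter m L x.
Proof. by elim: m => //= m ->; exact: lefZ. Qed.

Lemma DZ k c x : D k x -> D k (c *: x).
Proof. by move=> hx; rewrite -[c](subrK 1) scalerDl scale1r; exact: Dlin. Qed.

Lemma D_iter m k x : D k x -> D (k + m.*2) (iter m L x).
Proof.
by elim: m => [|m IH] hx; rewrite ?addn0 // doubleS !addnS; apply/DL/IH.
Qed.

(** The iterates of [L] on [x] have weights n - k - 2i, whose sum over i <= m is (m+1)(n-k-m). *)
Lemma Lam_iter m k x : D k x ->
  Lam (iter m.+1 L x)
  = iter m.+1 L (Lam x) + (m.+1%:R * (n%:R - k%:R - m%:R)) *: iter m L x.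
Proof.
move=> hx; elim: m => [|m IH]; first by rewrite /= (LamL hx) mul1r subr0.
rewrite [iter m.+2 L x]iterS (LamL (D_iter m.+1 hx)) IH lefD lefZ -!iterS.
rewrite -addrA -scalerDl; congr (_ + _ *: _).
by rewrite natrD -muln2 natrM -!natr1; ring.
Qed.

(** On a vector killed by [Lam] the coefficients (m+1)(n-k-m) of [Lam_iter] are nonzero for m < n-k,
    so powers of [L] can be stripped off one at a time. In general [Lam x], of degree two less,
    satisfies the same hypothesis, and strong induction leads back to that case. *)
Lemma lef_inj k x : (k <= n)%N -> D k x -> iter (n - k) L x = 0 -> x = 0.
Proof.
have prim j y : (j <= n)%N -> D j y -> iter (n - j) L y = 0 -> Lam y = 0 -> y = 0.
  move=> jn hy h0 hL.
  have : forall m, (m <= n - j)%N -> iter m L y = 0 -> y = 0.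
    elim=> [//|m IH] mn hm; apply: IH; first exact: ltnW.
    have := Lam_iter m hy; rewrite hm Lam_0 hL iter_lef0 add0r => /esym/eqP.
    rewrite scaler_eq0 => /orP[|/eqP//]; rewrite mulf_eq0 pnatr_eq0 /=.
    by rewrite -natrB // -natrB ?(ltnW mn) // pnatr_eq0 subn_eq0 leqNgt mn.
  by move=> /(_ _ (leqnn _) h0).
elim/ltn_ind: k x => k IH x kn hx h0; apply: (prim k) => //.
case: k IH kn hx h0 => [|[|k]] IH kn hx h0; [exact: Lam0|exact: Lam1|].
apply: (IH k) => //; [lia | exact: DLam|].
have e : (n - k = (n - k.+2).+2)%N by lia.
have := Lam_iter (n - k.+2) hx; rewrite [iter _.+1 L x]iterS h0 lef0 Lam_0.
rewrite scaler0 addr0 e => /esym h; by rewrite iterS h lef0.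
Qed.

Definition prim k x := [/\ (k <= n)%N, D k x & iter (n - k).+1 L x = 0].

(** The coefficient of [Lam_iter] vanishes at m = n-k, so L^(n-k+1) kills [Lam x] as well, while
    L^(n-k+2) is injective in degree k-2. *)
Lemma prim_Lam k x : prim k x -> Lam x = 0.
Proof.
case=> kn hx h0; case: k kn hx h0 => [|[|k]] kn hx h0; [exact: Lam0|exact: Lam1|].
apply: (@lef_inj k) => //; [lia | exact: DLam|].
have e : (n - k = (n - k.+2).+2)%N by lia.
have := Lam_iter (n - k.+2) hx; rewrite h0 Lam_0.
rewrite -natrB // subrr mulr0 scale0r addr0 e => /esym h; by rewrite iterS h lef0.
Qed.

Lemma Lam_iter_prim m k x : prim k x ->
  Lam (iter m.+1 L x) = (m.+1%:R * (n%:R - k%:R - m%:R)) *: iter m L x.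
Proof.
move=> hx; rewrite (@Lam_iter m k) ?(prim_Lam hx) ?iter_lef0 ?add0r //.
by case: hx.
Qed.

(** The constant is the product of (j+1)(n-k-j) over j < i, nonzero in this range. *)
Lemma iter_Lam_iter i k x : prim k x -> (i <= n - k)%N ->
  exists2 c, c != 0 & iter i Lam (iter i L x) = c *: x.
Proof.
move=> hx; elim: i => [|i IH] hi; first by exists 1; rewrite ?oner_eq0 ?scale1r.
have [c c0 hc] := IH (ltnW hi).
exists ((i.+1%:R * (n%:R - k%:R - i%:R)) * c).
  have kn : (k <= n)%N by case: hx.
  rewrite !mulf_neq0 // ?pnatr_eq0 // -natrB // -natrB ?(ltnW hi) //.
  by rewrite pnatr_eq0 subn_eq0 leqNgt hi.
rewrite iterSr (Lam_iter_prim i hx).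
have -> m a y : iter m Lam (a *: y) = a *: iter m Lam y.
  by elim: m => //= m ->; exact: LamZ.
by rewrite hc scalerA.
Qed.

Lemma iter_Lam_iter_lt i j k x : prim k x -> (i < j)%N ->
  iter j Lam (iter i L x) = 0.
Proof.
move=> hx; have Z m : iter m Lam 0 = 0 by elim: m => //= m ->; exact: Lam_0.
elim: j i => // j IH [|i] hij; rewrite iterSr.
  by rewrite (prim_Lam hx) Z.
rewrite (Lam_iter_prim i hx).
have -> m a y : iter m Lam (a *: y) = a *: iter m Lam y.
  by elim: m => //= m ->; exact: LamZ.
by rewrite IH ?scaler0.
Qed.

(** Peels off the top term: as many applications of [Lam] as its exponent kill all lower powers of
    [L] and multiply its primitive factor by a nonzero constant. *)
Lemma lefschetz_unique N K (b : nat -> X) :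
  (forall i, (i < N)%N -> b i = 0 \/ (prim (K - i.*2) (b i) /\ (i <= n - (K - i.*2))%N)) ->
  \sum_(i < N) iter i L (b i) = 0 -> forall i, (i < N)%N -> b i = 0.
Proof.
elim: N => [//|N IH] hb h0.
have iLD j x y : iter j Lam (x + y) = iter j Lam x + iter j Lam y.
  by elim: j => //= j ->; exact: LamD.
have iL0 j : iter j Lam 0 = 0 by elim: j => //= j ->; exact: Lam_0.
have iLs j m (F : 'I_m -> X) :
    iter j Lam (\sum_i F i) = \sum_i iter j Lam (F i).
  by elim: (index_enum _) => [|i l h]; rewrite ?big_nil ?big_cons ?iL0 ?iLD ?h.
have bN : b N = 0.
  have [//|[hp hN]] := hb N (ltnSn _).
  have := congr1 (iter N Lam) h0; rewrite iLs iL0 big_ord_recr /= big1 => [|i _].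
    have [c c0 ->] := iter_Lam_iter hp hN.
    by rewrite add0r => /eqP; rewrite scaler_eq0 (negbTE c0) => /eqP.
  have [->|[hpi _]] := hb i (ltnW (ltn_ord i)); first by rewrite iter_lef0 iL0.
  exact: iter_Lam_iter_lt hpi (ltn_ord i).
move=> i; rewrite ltnS leq_eqVlt => /predU1P[->//|hi].
apply: IH hi => [j hj|]; first by apply: hb; exact: ltnW.
by move: h0; rewrite big_ord_recr /= bN iter_lef0 addr0.
Qed.

Section two_terms.
Context (k : nat) (e : X).
Hypotheses (kn : (k <= n)%N) (he : D k.+1 e) (he0 : iter (n - k).+1 L e = 0).
Let c : R := (n - k).+1%:R.
(** If [e = b0 + L b1] with [b0] and [b1] primitive of degrees k+1 and k-1, then
    [Lam e = (n-k+1) b1], which forces this formula and the constant [c]. *)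
Definition lef_quot := c^-1 *: Lam e.
Definition lef_rem := e - L lef_quot.

Lemma lef_quot_deg0 : k = 0%N -> lef_quot = 0.
Proof. by move=> k0; rewrite /lef_quot Lam1 ?scaler0 // -k0. Qed.

(** Commuting [Lam] past L^(n-k+2), one power more than in [he0], leaves only a multiple of
    L^(n-k+1) e, which is 0. *)
Lemma lef_quot_prim : (0 < k)%N -> prim k.-1 lef_quot.
Proof.
move=> k0; have ek : k = k.-1.+1 by rewrite prednK.
have hj : D k.-1.+2 e by rewrite -ek.
split; [lia | exact/DZ/DLam|].
have -> : (n - k.-1 = (n - k).+1)%N by lia.
rewrite iter_lefZ; have := Lam_iter (n - k).+1 hj.
rewrite [iter _.+2 L e]iterS he0 lef0 Lam_0 scaler0 addr0 => <-.
by rewrite scaler0.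
Qed.

(** In degree k+1 and at m = n-k the coefficient of [Lam_iter] is -(n-k+1), which the division by
    [c] normalises. *)
Lemma iter_lef_rem : iter (n - k) L lef_rem = 0.
Proof.
rewrite /lef_rem -scaleN1r iter_lefD iter_lefZ -iterSr /lef_quot iter_lefZ.
have := Lam_iter (n - k) he; rewrite he0 Lam_0.
have -> : n%:R - k.+1%:R - (n - k)%:R = -1 :> R.
  by rewrite natrB // -natr1; ring.
rewrite mulrN1 scaleNr => /esym/eqP; rewrite subr_eq0 => /eqP ->.
by rewrite (scalerA c^-1) mulVf ?pnatr_eq0 // scale1r scaleN1r subrr.
Qed.

(** For k = n no power of [L] is left in [iter_lef_rem]. *)
Lemma lef_rem_top : k = n -> lef_rem = 0.
Proof. by move=> kn'; have := iter_lef_rem; have -> : (n - k = 0)%N by lia. Qed.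

Lemma lef_rem_prim : (k < n)%N -> prim k.+1 lef_rem.
Proof.
move=> hk; split=> //; last first.
  by rewrite subnSK //; exact: iter_lef_rem.
have [k0|k0] := posnP k.
  by rewrite /lef_rem lef_quot_deg0 // lef0 subr0.
rewrite /lef_rem -scaleN1r addrC; apply: Dlin => //.
by have [_ + _] := lef_quot_prim k0; move=> /DL; rewrite prednK.
Qed.

End two_terms.
End sl2.

(** * Contraction with the inverse symplectic form and the sl2 relation *)

Section contraction.
Context (R : realType) (m r : nat).
Implicit Types (f : seq 'rV[R]_m -> 'cV[R]_r) (P : 'M[R]_m).

(** Contraction with the bivector of matrix [P]; the sum runs over ordered pairs, so each unordered
    pair is met twice. *)
Definition dual_contract P f : seq 'rV[R]_m -> 'cV[R]_r := fun s =>
  \sum_i \sum_j P i j *: f (delta_mx 0 i :: delta_mx 0 j :: s).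

Lemma dual_contract_lin P c f g :
  dual_contract P (fun s => c *: f s + g s)
  = fun s => c *: dual_contract P f s + dual_contract P g s.
Proof.
apply/funext => s; rewrite /dual_contract scaler_sumr -big_split.
apply: eq_bigr => i _ /=; rewrite scaler_sumr -big_split.
by apply: eq_bigr => j _ /=; rewrite scalerDr !scalerA mulrC.
Qed.

Lemma alternating_dual_contract P k f : alternating k f ->
  alternating k.-2 (dual_contract P f).
Proof.
move=> hf; rewrite /dual_contract.
have hs I (l : seq I) (F : I -> seq 'rV[R]_m -> 'cV[R]_r) (c : I -> R) :
    (forall i, alternating k.-2 (F i)) ->
    alternating k.-2 (fun s => \sum_(i <- l) c i *: F i s).
  move=> hF; elim: l => [|i l IH].
    have -> : (fun s => \sum_(i <- [::]) c i *: F i s) = (fun _ : seq 'rV[R]_m => 0).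
      by apply/funext => s; rewrite big_nil.
    exact: alternating0.
  have -> : (fun s => \sum_(j <- i :: l) c j *: F j s)
      = (fun s => c i *: F i s + \sum_(j <- l) c j *: F j s).
    by apply/funext => s; rewrite big_cons.
  exact: alternating_lin.
have := hs _ (index_enum _) (fun i s => \sum_j P i j *: f (delta_mx 0 i :: delta_mx 0 j :: s))
  (fun=> 1).
have -> : (fun s => \sum_i 1 *: (\sum_j P i j *: f (delta_mx 0 i :: delta_mx 0 j :: s)))
  = (fun s => \sum_i \sum_j P i j *: f (delta_mx 0 i :: delta_mx 0 j :: s)).
  by apply/funext => s; apply: eq_bigr => i _; rewrite scale1r.
apply=> i; apply: (hs _ _ (fun j s => f (delta_mx 0 i :: delta_mx 0 j :: s))) => j.
rewrite -[k.-2]/(k.-1.-1).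
by have := alternating_contract (delta_mx 0 j) (alternating_contract (delta_mx 0 i) hf).
Qed.

Lemma dual_contract_low P k f : alternating k f -> (k < 2)%N -> dual_contract P f = 0.
Proof.
move=> hf hk; apply/funext => s; rewrite /dual_contract big1 // => i _.
rewrite big1 // => j _; rewrite (alternating_hom hf) ?scaler0 //=.
by apply/eqP => e; move: hk; rewrite -e.
Qed.

(** The coordinate 1-form dx_i. *)
Definition coord_form (i : 'I_m) : seq 'rV[R]_m -> R^o := fun s =>
  if s is [:: v] then v 0 i else 0.

(* Euler's identity *)
Lemma sum_coord_wedge f s : slot_linear f -> adjacent_vanish f ->
  \sum_i wedge *:%R (coord_form i) (contract (delta_mx 0 i) f) s = (size s)%:R *: f s.
Proof.
have hb := @bilin_scale R 'cV[R]_r.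
elim: s f => [|u s IH] f hl ha.
  by rewrite scale0r big1 // => i _; rewrite wedge_nil scale0r.
under eq_bigr => i _ do rewrite (wedge_cons hb).
rewrite big_split /=.
have -> : \sum_i wedge *:%R (contract u (coord_form i)) (contract (delta_mx 0 i) f) s
   = f (u :: s).
  rewrite [u in RHS]row_sum_delta slot_linear_sum //; apply: eq_bigr => i _.
  rewrite (wedge_deg0 hb) //=; by case.
have -> : \sum_i wedge *:%R (grade_inv (coord_form i))
     (contract u (contract (delta_mx 0 i) f)) s = (size s)%:R *: f (u :: s).
  rewrite -[f _]/(contract u f s) -IH;
    [|exact: slot_linear_contract|exact: adjacent_vanish_contract].
  apply: eq_bigr => i _.
  have -> : grade_inv (coord_form i) = fun s => (-1) *: coord_form i s.
    apply/funext => -[|v [|v' t]]; rewrite /grade_inv /= ?scaler0 //.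
  have -> : contract u (contract (delta_mx 0 i) f)
     = fun s => (-1) *: contract (delta_mx 0 i) (contract u f) s.
    by apply/funext => t; rewrite scaleN1r; exact: (@swap_adjacent _ _ _ f [::]).
  by rewrite (wedgeZl hb) (wedgeZr hb) scalerA mulrNN mulr1 scale1r.
by rewrite -natr1 scalerDl scale1r addrC.
Qed.

End contraction.

Section symplectic_linear.
Context (R : realType) (n r : nat) (w : seq 'rV[R]_n.*2 -> R^o).
Hypothesis hw : alternating 2 w.

Definition gram : 'M[R]_n.*2 := \matrix_(i, j) w [:: delta_mx 0 i; delta_mx 0 j].

Hypothesis gram_unit : gram \in unitmx.

Definition lef_at (f : seq 'rV[R]_n.*2 -> 'cV[R]_r) := wedge *:%R w f.
(** The factor 1/2 offsets the double count of pairs of indices, and the sign is the one for which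
    [Lam L] multiplies 0-forms by +n. *)
Definition Lam_at (f : seq 'rV[R]_n.*2 -> 'cV[R]_r) :=
  dual_contract (- 2^-1 *: invmx gram) f.

Lemma gramC : gram^T = - gram.
Proof.
apply/matrixP => i j; rewrite !mxE.
exact: (@swap_adjacent _ _ _ w [::] [::] _ _ (alternating_linear hw) (alternating_adjacent hw)).
Qed.

Lemma form_row (i : 'I_n.*2) v :
  w [:: delta_mx 0 i; v] = \sum_j gram i j * v 0 j.
Proof.
rewrite [v in LHS]row_sum_delta.
have := slot_linear_sum (fun j => v 0 j) (fun j => delta_mx 0 j) [::]
  (slot_linear_contract (delta_mx 0 i) (alternating_linear hw)).
rewrite /contract => ->; apply: eq_bigr => j _; by rewrite mxE mulrC.
Qed.

(** Contracting [w] with its inverse matrix yields dx_i: this is how Euler's identity enters the sl2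
    relation. *)
Lemma sum_inv_gram i v :
  \sum_j invmx gram i j * w [:: delta_mx 0 j; v] = v 0 i.
Proof.
under eq_bigr => j _ do rewrite form_row mulr_sumr.
rewrite exchange_big /= (bigD1 i) //= [X in _ + X]big1 => [|l li].
  under eq_bigr => j _ do rewrite mulrA.
  rewrite -mulr_suml addr0.
  have := congr1 (fun A : 'M[R]_(n.*2) => A i i) (mulVmx gram_unit).
  by rewrite !mxE eqxx => ->; rewrite mul1r.
under eq_bigr => j _ do rewrite mulrA.
rewrite -mulr_suml.
have := congr1 (fun A : 'M[R]_(n.*2) => A i l) (mulVmx gram_unit).
by rewrite !mxE eq_sym (negbTE li) => ->; rewrite mul0r.
Qed.

Lemma inv_gramC i j : invmx gram i j = - invmx gram j i.
Proof.
have : (invmx gram)^T = - invmx gram.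
  by rewrite trmx_inv gramC -[- gram]scaleN1r invmxZ ?invrN1 ?scaleN1r // -gramC unitmx_tr.
by move=> /(congr1 (fun A : 'M[R]_(n.*2) => A j i)); rewrite !mxE.
Qed.

(** Inserting two vectors into the product of [w] and [f] gives four terms. The one with w(u, v)
    contributes a trace, equal to n; each of the two cross terms contributes -k/2 by
    [sum_coord_wedge]; the last is L Lam. *)
Lemma LamL_at k (f : seq 'rV[R]_n.*2 -> 'cV[R]_r) : alternating k f ->
  Lam_at (lef_at f) = lef_at (Lam_at f) + (n%:R - k%:R) *: f.
Proof.
move=> hf; have hb := @bilin_scale R 'cV[R]_r.
apply/funext => s; rewrite fctE.
rewrite [X in _ = _ + X]/GRing.scale /=.
pose e i : 'rV[R]_n.*2 := delta_mx 0 i.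
pose P := invmx gram.
have exp2 u v : lef_at f (u :: v :: s)
    = w [:: u; v] *: f s - wedge *:%R (contract u w) (contract v f) s
      + wedge *:%R (contract v w) (contract u f) s + lef_at (contract v (contract u f)) s.
  rewrite /lef_at (wedge_cons hb).
  rewrite (grade_inv_parity (alternating_parity hw)) /= expr0.
  have -> : (fun s => 1 *: w s) = w by apply/funext => t; rewrite scale1r.
  rewrite !(wedge_cons hb).
  rewrite (grade_inv_parity (alternating_parity hw)) /= expr0.
  have -> : (fun s => 1 *: w s) = w by apply/funext => t; rewrite scale1r.
  have hu := alternating_contract u hw.
  rewrite (grade_inv_parity (alternating_parity hu)) /= expr1 (wedgeZl hb) scaleN1r.
  have h0 t : size t != 0%N -> contract v (contract u w) t = 0.
    exact (alternating_hom (alternating_contract v hu) (s:=t)).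
  rewrite (wedge_deg0 hb _ _ h0).
  by rewrite addrA.
rewrite /Lam_at {1}/dual_contract.
under eq_bigr => i _ do under eq_bigr => j _ do rewrite exp2 mxE !scalerDr.
under eq_bigr => i _ do rewrite !big_split /=.
rewrite !big_split /=.
(* Each of the 2n indices contributes 1/2, by the diagonal case of [sum_inv_gram]. *)
have -> : \sum_i \sum_j (- 2^-1 * P i j) *: (w [:: e i; e j] *: f s) = n%:R *: f s.
  transitivity (\sum_(i < n.*2) 2^-1 *: f s).
    apply: eq_bigr => i _; under eq_bigr => j _ do rewrite scalerA.
    rewrite -scaler_suml; congr (_ *: _).
    transitivity (\sum_j 2^-1 * (P i j * w [:: e j; e i])).
      apply: eq_bigr => j _.
      have -> : w [:: e i; e j] = - w [:: e j; e i].
        exact: (@swap_adjacent _ _ _ w [::] [::] _ _ (alternating_linear hw) (alternating_adjacent hw)).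
      by rewrite mulNr mulrN mulNr opprK mulrA.
    by rewrite -mulr_sumr sum_inv_gram mxE !eqxx mulr1.
  rewrite sumr_const card_ord -scaler_nat scalerA; congr (_ *: _).
  by rewrite -mul2n natrM; field.
have ek i : (fun t => \sum_j P i j *: contract (e j) w t) = coord_form i.
  apply/funext => -[|v [|v' t]] /=.
  - by rewrite big1 // => j _; rewrite /contract (alternating_hom hw) ?scaler0.
  - exact: sum_inv_gram.
  - by rewrite big1 // => j _; rewrite /contract (alternating_hom hw) ?scaler0.
have sk : \sum_i wedge *:%R (coord_form i) (contract (e i) f) s = k%:R *: f s.
  rewrite (sum_coord_wedge _ (alternating_linear hf) (alternating_adjacent hf)).
  have [<- //|hs] := eqVneq (size s) k.
  by rewrite (alternating_hom hf) // !scaler0.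
have h2 : \sum_i \sum_j (- 2^-1 * P i j) *: wedge *:%R (contract (e j) w) (contract (e i) f) s
   = (- 2^-1 * k%:R) *: f s.
  rewrite -scalerA -sk scaler_sumr; apply: eq_bigr => i _.
  rewrite -ek (wedge_suml hb) scaler_sumr; apply: eq_bigr => j _.
  by rewrite (wedgeZl hb) scalerA.
(* Exchanging the indices and using the antisymmetry of [P] turns this cross term into the previous
   one. *)
have h1 : \sum_i \sum_j (- 2^-1 * P i j) *: - wedge *:%R (contract (e i) w) (contract (e j) f) s
   = (- 2^-1 * k%:R) *: f s.
  rewrite exchange_big -h2; apply: eq_bigr => i _; apply: eq_bigr => j _ /=.
  by rewrite /P inv_gramC mulrN scaleNr scalerN opprK.
rewrite h1 h2.
have -> : \sum_i \sum_j (- 2^-1 * P i j) *: lef_at (contract (e j) (contract (e i) f)) s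
   = lef_at (dual_contract (- 2^-1 *: invmx gram) f) s.
  rewrite /lef_at /dual_contract (wedge_sumr hb); apply: eq_bigr => i _.
  rewrite (wedge_sumr hb); apply: eq_bigr => j _.
  by rewrite (wedgeZr hb) mxE.
rewrite addrC -!scalerDl; congr (_ + _ *: _).
by field.
Qed.

Lemma lef_at_lin c f g : lef_at (c *: f + g) = c *: lef_at f + lef_at g.
Proof.
have hb := @bilin_scale R 'cV[R]_r.
by apply/funext => s; rewrite /lef_at [LHS](wedge_linr hb).
Qed.

Lemma Lam_at_lin c f g : Lam_at (c *: f + g) = c *: Lam_at f + Lam_at g.
Proof. exact: dual_contract_lin. Qed.

End symplectic_linear.

(** * Smooth functions *)

Section smooth.
Context (R : realType) (V : normedModType R).
Implicit Types U : set V.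

(** The first-order expansion of [f] at [x] is one for [g], and its uniqueness identifies the
    differential of [g]. *)
Lemma near_eq_differentiable (W : normedModType R) (f g : V -> W) (x : V) :
  (\near x, f x = g x) -> differentiable f x -> differentiable g x.
Proof.
move=> fg df.
have gx : f x = g x := nbhs_singleton fg.
have e : g \o shift x = cst (g x) + 'd f x +o_ 0 id.
  have /diff_locally /eqaddoP h := df; apply/eqaddoP => _/posnumP[eps].
  have fg' : \forall h \near 0, f (h + x) = g (h + x).
    by move: fg; rewrite (near_shift 0) subr0.
  near=> y; have : `|(f \o shift x - (cst (f x) + 'd f x)) y| <= eps%:num * `|y|.
    by near: y; exact: h.
  rewrite !fctE /= gx -[f (y + x)]/((f \o shift x) y) /=.
  by have -> : f (y + x) = g (y + x) by near: y.
apply/diff_locallyP; have := diff_unique (diff_continuous df) e.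
move=> dgE; rewrite dgE; split=> //; exact: diff_continuous.
Unshelve. all: by end_near. Qed.

(** Openness makes agreement on [U] hold near each of its points, so the derivatives agree on [U]
    too and the induction can continue. *)
Lemma Ck_on_ext (W : normedModType R) k U (f g : V -> W) : open U ->
  (forall x, U x -> f x = g x) -> Ck_on k U f -> Ck_on k U g.
Proof.
move=> oU; have nearU (h h' : V -> W) x : U x -> (forall x, U x -> h x = h' x) ->
    \near x, h x = h' x.
  by move=> Ux hh; move: (open_nbhs_nbhs (conj oU Ux)); apply: filterS.
elim: k f g => [|k IH] f g fg /=.
  move=> hf x Ux; rewrite /prop_for /continuous_at -(fg x Ux).
  apply: cvg_trans (hf x Ux); apply: near_eq_cvg; exact: nearU.
move=> [df Df]; split=> [x Ux|v].
  by apply: near_eq_differentiable (df x Ux); exact: nearU.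
apply: IH (Df v) => x Ux; apply: near_eq_derive; exact: nearU.
Qed.

Lemma smooth_on_ext (W : normedModType R) U (f g : V -> W) : open U ->
  (forall x, U x -> f x = g x) -> smooth_on U f -> smooth_on U g.
Proof. by move=> oU fg hf k; exact: Ck_on_ext (hf k). Qed.

Lemma Ck_onW (W : normedModType R) k U (f : V -> W) : Ck_on k.+1 U f -> Ck_on k U f.
Proof.
elim: k f => [|k IH] f [df Df] /=.
  by move=> x Ux; exact/differentiable_continuous/df.
by split=> // v; exact: IH.
Qed.

Lemma smooth_on_differentiable (W : normedModType R) U (f : V -> W) x :
  smooth_on U f -> U x -> differentiable f x.
Proof. by move=> /(_ 1%N)[h _] /h. Qed.

Lemma smooth_on_derivable (W : normedModType R) U (f : V -> W) x v :
  smooth_on U f -> U x -> derivable f x v.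
Proof. by move=> hf Ux; exact/diff_derivable/(smooth_on_differentiable hf). Qed.

Lemma smooth_on_derive (W : normedModType R) U (f : V -> W) v :
  smooth_on U f -> smooth_on U (fun x => 'D_v f x).
Proof. by move=> h k; have [_ /(_ v)] := h k.+1. Qed.

Lemma Ck_on_cst (W : normedModType R) k U (a : W) : Ck_on k U (fun _ : V => a).
Proof.
elim: k a => [|k IH] a /=; first by move=> x _; exact: cst_continuous.
split=> [x _|v]; first exact: differentiable_cst.
have -> : (fun x : V => 'D_v (fun=> a) x) = fun=> 0.
  by apply/funext => x; exact: derive_cst.
exact: IH.
Qed.

Lemma smooth_on_cst (W : normedModType R) U (a : W) : smooth_on U (fun _ : V => a).
Proof. by move=> k; exact: Ck_on_cst. Qed.

Lemma Ck_onD (W : normedModType R) k U (f g : V -> W) : open U ->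
  Ck_on k U f -> Ck_on k U g -> Ck_on k U (fun x => f x + g x).
Proof.
move=> oU; elim: k f g => [|k IH] f g /=.
  by move=> hf hg x Ux; apply: cvgD; [exact: hf|exact: hg].
move=> [df Df] [dg Dg]; split=> [x Ux|v].
  exact: (differentiableD (df x Ux) (dg x Ux)).
apply: Ck_on_ext (IH _ _ (Df v) (Dg v)) => // x Ux.
apply/esym; apply: deriveD; apply: diff_derivable; [exact: df|exact: dg].
Qed.

Lemma smooth_onD (W : normedModType R) U (f g : V -> W) : open U ->
  smooth_on U f -> smooth_on U g -> smooth_on U (fun x => f x + g x).
Proof. by move=> oU hf hg k; exact: Ck_onD. Qed.

Lemma smooth_on_sum (W : normedModType R) U (I : Type) (r : seq I) (P : pred I)
  (F : I -> V -> W) : open U -> (forall i, smooth_on U (F i)) ->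
  smooth_on U (fun x => \sum_(i <- r | P i) F i x).
Proof.
move=> oU hF; elim: r => [|i r IH].
  by apply: (smooth_on_ext oU _ (@smooth_on_cst W U 0)) => x _; rewrite big_nil.
case Pi : (P i); last by apply: smooth_on_ext IH => // x _; rewrite big_cons Pi.
by apply: (smooth_on_ext oU _ (smooth_onD oU (hF i) IH)) => x _; rewrite big_cons Pi.
Qed.

(** Exactly what an induction on the order of differentiability consumes, packaged so that
    smoothness and the product rule of [wedge] are proved once for both scaling and [mulmx]. *)
Definition leibniz (W1 W2 W3 : normedModType R) (op : W1 -> W2 -> W3) :=
  [/\ bilin op,
   forall (f : V -> W1) (g : V -> W2) x, {for x, continuous f} ->
     {for x, continuous g} -> {for x, continuous (fun y => op (f y) (g y))} &
   forall (f : V -> W1) (g : V -> W2) x, differentiable f x -> differentiable g x ->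
     differentiable (fun y => op (f y) (g y)) x /\
     forall v, 'D_v (fun y => op (f y) (g y)) x = op ('D_v f x) (g x) + op (f x) ('D_v g x)].

Section leibniz.
Context (W1 W2 W3 : normedModType R) (op : W1 -> W2 -> W3) (hop : leibniz op).

Lemma leibniz_bilin : bilin op. Proof. by case: hop. Qed.

Lemma leibniz_derive (f : V -> W1) (g : V -> W2) x v :
  differentiable f x -> differentiable g x ->
  'D_v (fun y => op (f y) (g y)) x = op ('D_v f x) (g x) + op (f x) ('D_v g x).
Proof. by case: hop => _ _ h df dg; have [_] := h f g x df dg; exact. Qed.

(** Each term of the product rule keeps one factor undifferentiated; [Ck_onW] lowers its order to
    that of the other. *)
Lemma Ck_on_leibniz k U (f : V -> W1) (g : V -> W2) : open U ->
  Ck_on k U f -> Ck_on k U g -> Ck_on k U (fun x => op (f x) (g x)).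
Proof.
case: hop => _ hc hd oU; elim: k f g => [|k IH] f g.
  by move=> hf hg x Ux; apply: hc; [exact: hf|exact: hg].
move=> hf hg; have hf' := Ck_onW hf; have hg' := Ck_onW hg.
case: hf => [df Df]; case: hg => [dg Dg]; split=> [x Ux|v].
  by have [] := hd f g x (df x Ux) (dg x Ux).
apply: Ck_on_ext (Ck_onD oU (IH _ _ (Df v) hg') (IH _ _ hf' (Dg v))) => // x Ux.
by have [_ ->] := hd f g x (df x Ux) (dg x Ux).
Qed.

Lemma smooth_on_leibniz U (f : V -> W1) (g : V -> W2) : open U ->
  smooth_on U f -> smooth_on U g -> smooth_on U (fun x => op (f x) (g x)).
Proof. by move=> oU hf hg k; exact: Ck_on_leibniz. Qed.
End leibniz.

Lemma differentiable_scale (W : normedModType R) (f : V -> R^o) (g : V -> W) x :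
  differentiable f x -> differentiable g x ->
  differentiable (fun y => f y *: g y) x /\
  forall v, 'D_v (fun y => f y *: g y) x = 'D_v f x *: g x + f x *: 'D_v g x.
Proof.
move=> df dg.
have bl : bilinear_for (GRing.Scale.Law.clone _ _ *:%R _)
    (GRing.Scale.Law.clone _ _ *:%R _) ( *:%R : R^o -> W -> W).
  split=> [u'|u] a y z /=; first by rewrite scalerDl scalerA.
  by rewrite scalerDr !scalerA mulrC.
(* Scaling is packed as a continuous bilinear map and composed with the pair of [f] and [g]. *)
pose B0 := bilinear_isBilinear.Build R R^o W W _ _ ( *:%R : R^o -> W -> W) bl.
pose B : {bilinear R^o -> W -> W} := HB.pack ( *:%R : R^o -> W -> W) B0.
have cB : continuous (fun p : R^o * W => B p.1 p.2) by move=> p; exact: scale_continuous.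
have dB p : differentiable (fun p => B p.1 p.2) p := differentiable_bilin _ cB.
have dp := differentiable_pair df dg.
have -> : (fun y => f y *: g y) = (fun p => B p.1 p.2) \o (fun y => (f y, g y)) by [].
have dc := differentiable_comp dp (dB _).
split=> // v; rewrite deriveE // diff_comp //.
have e := @diff_bilin _ _ _ _ B (f x, g x) cB.
rewrite e diff_pair //=.
by rewrite -!deriveE // addrC.
Qed.

Lemma leibniz_scale (W : normedModType R) : leibniz ( *:%R : R^o -> W -> W).
Proof.
split; first exact: bilin_scale; last exact: differentiable_scale.
by move=> f g x cf cg; exact: (cvgZ cf cg).
Qed.


Lemma smooth_on_scale (W : normedModType R) U (f : V -> R^o) (g : V -> W) : open U ->
  smooth_on U f -> smooth_on U g -> smooth_on U (fun x => f x *: g x).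
Proof. exact: (smooth_on_leibniz (leibniz_scale W)). Qed.

Lemma smooth_onZ (W : normedModType R) U (c : R) (g : V -> W) : open U ->
  smooth_on U g -> smooth_on U (fun x => c *: g x).
Proof. by move=> oU; apply: (@smooth_on_scale W U (fun=> c)) => //; exact: smooth_on_cst. Qed.

Lemma smooth_on_mul U (f g : V -> R^o) : open U ->
  smooth_on U f -> smooth_on U g -> smooth_on U (fun x => f x * g x : R^o).
Proof. exact: (@smooth_on_scale R^o). Qed.

Lemma smooth_on_prod U (I : Type) (r : seq I) (P : pred I) (F : I -> V -> R^o) :
  open U -> (forall i, smooth_on U (F i)) ->
  smooth_on U (fun x => \prod_(i <- r | P i) F i x : R^o).
Proof.
move=> oU hF; elim: r => [|i r IH].
  by apply: (smooth_on_ext oU _ (@smooth_on_cst R^o U 1)) => x _; rewrite big_nil.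
case Pi : (P i); last by apply: (smooth_on_ext oU _ IH) => x _; rewrite big_cons Pi.
by apply: (smooth_on_ext oU _ (smooth_on_mul oU (hF i) IH)) => x _; rewrite big_cons Pi.
Qed.

(** The derivative is -f^-2 times the derivative of [f], so it involves f^-1 only to the order
    already known. *)
Lemma smooth_on_inv U (f : V -> R^o) : open U -> (forall x, U x -> f x != 0) ->
  smooth_on U f -> smooth_on U (fun x => (f x)^-1 : R^o).
Proof.
move=> oU f0 hf k; elim: k => [|k IH].
  by move=> x Ux; apply: cvgV; [exact: f0|exact: (hf 0%N x Ux)].
split=> [x Ux|v].
  exact: differentiableV (smooth_on_differentiable hf Ux) (f0 x Ux).
have h : Ck_on k U (fun x => ((f x)^-1 * (f x)^-1) * (-1 * 'D_v f x) : R^o).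
  have hD : Ck_on k U (fun x => -1 * 'D_v f x : R^o).
    apply: (@smooth_on_mul U (fun=> -1)) => //; first exact: smooth_on_cst.
    exact: smooth_on_derive.
  apply: (Ck_on_leibniz (leibniz_scale R^o)) hD => //.
  exact: (Ck_on_leibniz (leibniz_scale R^o)).
apply: Ck_on_ext h => // x Ux.
rewrite deriveV; [|exact: f0|exact: smooth_on_derivable hf Ux].
by rewrite /GRing.scale /= -exprVn expr2; ring.
Qed.

Section matrices.
Context (p q : nat).
Implicit Types f : V -> 'M[R]_(p, q).

Lemma derive_coord f x v i j : differentiable f x ->
  'D_v (fun y => f y i j) x = ('D_v f x) i j.
Proof. by move=> df; rewrite (derive_mx (diff_derivable df)) mxE. Qed.

Lemma differentiable_coord_fun f x i j : differentiable f x ->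
  differentiable (fun y => f y i j : R^o) x.
Proof.
move=> df; apply: (@differentiable_comp _ _ _ _ f (fun N : 'M[R]_(p, q) => N i j : R^o)) => //.
exact: differentiable_coord.
Qed.

Lemma differentiable_mx f x :
  (forall i j, differentiable (fun y => f y i j : R^o) x) -> differentiable f x.
Proof.
move=> df.
have -> : f = \sum_i \sum_j (fun y => f y i j *: delta_mx i j).
  apply/funext => y; rewrite [LHS]matrix_sum_delta fct_sumE.
  by apply: eq_bigr => i _; rewrite fct_sumE.
apply: differentiable_sum => i; apply: differentiable_sum => j.
exact: (@differentiableZl _ _ _ (fun y => f y i j)).
Qed.

Lemma smooth_on_coord U f i j : open U ->
  smooth_on U f -> smooth_on U (fun x => f x i j : R^o).
Proof.
move=> oU hf k; elim: k f hf => [|k IH] f hf.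
  move=> x Ux; apply: (@continuous_comp _ _ _ f (fun N : 'M[R]_(p, q) => N i j : R^o)).
    exact: (hf 0%N x Ux).
  exact: coord_continuous.
split=> [x Ux|v].
  exact/differentiable_coord_fun/(smooth_on_differentiable hf).
apply: Ck_on_ext (IH _ (smooth_on_derive v hf)) => // x Ux.
by rewrite derive_coord //; exact: smooth_on_differentiable hf Ux.
Qed.

Lemma smooth_on_mx U f : open U ->
  (forall i j, smooth_on U (fun x => f x i j : R^o)) -> smooth_on U f.
Proof.
move=> oU hf.
have h : smooth_on U (fun x => \sum_i \sum_j f x i j *: delta_mx i j : 'M[R]_(p, q)).
  apply: smooth_on_sum => // i; apply: smooth_on_sum => // j.
  apply: (@smooth_on_scale _ U (fun x => f x i j)) => //; exact: smooth_on_cst.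
by apply: (smooth_on_ext oU _ h) => x _; rewrite -matrix_sum_delta.
Qed.

End matrices.

Lemma continuous_sum_at (W : normedModType R) n (F : 'I_n -> V -> W) (x : V) :
  (forall i, {for x, continuous (F i)}) ->
  {for x, continuous (fun y => \sum_i F i y)}.
Proof.
move=> hF; elim: (index_enum _) => [|i l IH].
  have -> : (fun y => \sum_(i <- [::]) F i y) = (fun=> 0).
    by apply/funext => y; rewrite big_nil.
  exact: cst_continuous.
have -> : (fun y => \sum_(j <- i :: l) F j y) = (fun y => F i y + \sum_(j <- l) F j y).
  by apply/funext => y; rewrite big_cons.
by apply: cvgD; [exact: hF|exact: IH].
Qed.

Lemma leibniz_mulmx p q r :
  leibniz (mulmx : 'M[R]_(p, q) -> 'M[R]_(q, r) -> 'M[R]_(p, r)).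
Proof.
split; first exact: bilin_mulmx.
  move=> f g x cf cg.
  have -> : (fun y => f y *m g y)
      = (fun y => \sum_i \sum_j (\sum_k f y i k * g y k j) *: delta_mx i j).
    apply/funext => y; rewrite [LHS]matrix_sum_delta; apply: eq_bigr => i _.
    by apply: eq_bigr => j _; rewrite mxE.
  apply: continuous_sum_at => i; apply: continuous_sum_at => j; apply: cvgZr_tmp.
  apply: continuous_sum_at => k; apply: cvgM.
    apply: (@continuous_comp _ _ _ f (fun N : 'M[R]_(p, q) => N i k : R)); first exact: cf.
    exact: coord_continuous.
  apply: (@continuous_comp _ _ _ g (fun N : 'M[R]_(q, r) => N k j : R)); first exact: cg.
  exact: coord_continuous.
move=> f g x df dg.
have e i j : (fun y => (f y *m g y) i j) = \sum_k (fun y => f y i k *: (g y k j : R^o)).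
  by apply/funext => y; rewrite mxE fct_sumE.
have dd : differentiable (fun y => f y *m g y) x.
  apply: differentiable_mx => i j; rewrite e; apply: differentiable_sum => k.
  by have [] := @differentiable_scale R^o (fun y => f y i k) (fun y => g y k j) x
    (differentiable_coord_fun i k df) (differentiable_coord_fun k j dg).
split=> // v; apply/matrixP => i j.
rewrite -derive_coord // e derive_sum; last first.
  move=> k; apply: diff_derivable.
  by have [] := @differentiable_scale R^o (fun y => f y i k) (fun y => g y k j) x
    (differentiable_coord_fun i k df) (differentiable_coord_fun k j dg).
rewrite !mxE -big_split; apply: eq_bigr => k _ /=.
have [_ ->] := @differentiable_scale R^o (fun y => f y i k) (fun y => g y k j) x
    (differentiable_coord_fun i k df) (differentiable_coord_fun k j dg).
by rewrite !derive_coord.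
Qed.

Lemma smooth_on_det p U (f : V -> 'M[R]_p) : open U ->
  (forall i j, smooth_on U (fun x => f x i j : R^o)) ->
  smooth_on U (fun x => \det (f x) : R^o).
Proof.
move=> oU hf; rewrite /determinant; apply: smooth_on_sum => // s.
apply: smooth_on_mul => //; first exact: smooth_on_cst.
exact: smooth_on_prod.
Qed.

(** Cramer's rule: the inverse is the adjugate divided by the determinant, and both are polynomial
    in the entries. *)
Lemma smooth_on_invmx p U (f : V -> 'M[R]_p) : open U ->
  (forall x, U x -> f x \in unitmx) -> smooth_on U f ->
  smooth_on U (fun x => invmx (f x)).
Proof.
move=> oU fu hf.
have hf' i j : smooth_on U (fun x => f x i j : R^o) by exact: smooth_on_coord.
have h : smooth_on U (fun x => (\det (f x))^-1 *: \adj (f x) : 'M[R]_p).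
  apply: (@smooth_on_scale _ U (fun x => (\det (f x))^-1)) => //.
    apply: smooth_on_inv => //; last exact: smooth_on_det.
    by move=> x /fu; rewrite unitmxE unitfE.
  apply: smooth_on_mx => // i j.
  have hc : smooth_on U (fun x => (-1) ^+ (j + i) * \det (row' j (col' i (f x))) : R^o).
    apply: smooth_on_mul => //; first exact: smooth_on_cst.
    apply: smooth_on_det => // k l.
    by apply: (smooth_on_ext oU _ (hf' (lift j k) (lift i l))) => x _; rewrite !mxE.
  by apply: (smooth_on_ext oU _ hc) => x _; rewrite mxE.
by apply: (smooth_on_ext oU _ h) => x Ux; rewrite /invmx fu.
Qed.

End smooth.

(** * Symmetry of second derivatives *)

Lemma ler_dist_half (R : realFieldType) (a b c e : R) :
  `|a - c| < e / 2 -> `|b - c| < e / 2 -> `|a - b| <= e.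
Proof.
move=> ac bc; have -> : a - b = (a - c) - (b - c) by ring.
by apply: (le_trans (ler_normB _ _)); rewrite [leRHS]splitr; apply: lerD; exact: ltW.
Qed.

Section schwarz.
Context (R : realType) (V : normedModType R).
Implicit Types (f : V -> R) (U : set V).

Lemma is_derive_line f p u t : derivable f (p + t *: u) u ->
  is_derive t 1 (fun s => f (p + s *: u)) ('D_u f (p + t *: u)).
Proof.
have e : (fun h : R => h^-1 *: (((fun s => f (p + s *: u)) \o shift t) (h *: 1) - f (p + t *: u)))
       = (fun h : R => h^-1 *: ((f \o shift (p + t *: u)) (h *: u) - f (p + t *: u))).
  apply/funext => h /=; congr (_ *: (f _ - _)).
  have -> : h *: (1 : R) = h by exact: mulr1.
  by rewrite scalerDl addrCA.
by move=> hd; split; rewrite /derivable /derive e.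
Qed.

Lemma mvt_line f p u (h : R) : 0 < h ->
  (forall t, 0 <= t <= h -> differentiable f (p + t *: u)) ->
  exists2 t, 0 <= t <= h & f (p + h *: u) - f p = h * 'D_u f (p + t *: u).
Proof.
move=> h0 hd.
have dl t : 0 <= t <= h ->
    is_derive t 1 (fun s => f (p + s *: u)) ('D_u f (p + t *: u)).
  by move=> ht; apply: is_derive_line; exact/diff_derivable/hd.
have [t|t|t th] := @MVT R (fun s => f (p + s *: u)) (fun t => 'D_u f (p + t *: u)) 0 h h0.
- by rewrite in_itv /= => /andP[t0 th]; apply: dl; rewrite !ltW.
- apply: derivable_within_continuous => t'; rewrite in_itv /= => ht'.
  by have [] := dl t' ht'.
- rewrite scale0r addr0 subr0 mulrC => e; exists t => //.
  by move: th; rewrite in_itv /= => /andP[t0 th]; rewrite !ltW.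
Qed.

Lemma derive_shift_arg f q u w : 'D_u (fun y => f (y + w)) q = 'D_u f (q + w).
Proof.
have e : (fun h : R => h^-1 *: (((fun y => f (y + w)) \o shift q) (h *: u) - f (q + w)))
       = (fun h : R => h^-1 *: ((f \o shift (q + w)) (h *: u) - f (q + w))).
  by apply/funext => h /=; rewrite addrA.
by rewrite /derive e.
Qed.

(** The mean value theorem along [u] for the increment f(y + hv) - f(y), then along [v] for the
    derivative of [f] along [u]. *)
Lemma second_difference f p u v (h : R) : 0 < h ->
  (forall s t, 0 <= s <= h -> 0 <= t <= h ->
     differentiable f (p + s *: u + t *: v) /\
     differentiable (fun y => 'D_u f y) (p + s *: u + t *: v)) ->
  exists s t, [/\ 0 <= s <= h, 0 <= t <= h &
    f (p + h *: u + h *: v) - f (p + h *: u) - f (p + h *: v) + f p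
    = h * (h * 'D_v (fun y => 'D_u f y) (p + s *: u + t *: v))].
Proof.
move=> h0 hd; have hh : 0 <= h <= h by rewrite lexx (ltW h0).
have h00 : 0 <= (0 : R) <= h by rewrite lexx (ltW h0).
pose g y := f (y + h *: v) - f y.
have dsh s : 0 <= s <= h -> differentiable (fun y => f (y + h *: v)) (p + s *: u).
  move=> hs; apply: (@differentiable_comp _ _ _ _ (fun y => y + h *: v) f).
    by apply: differentiableD => //; exact: differentiable_cst.
  by have [] := hd s h hs hh.
have df0 s : 0 <= s <= h -> differentiable f (p + s *: u).
  by move=> hs; have [] := hd s 0 hs h00; rewrite scale0r addr0.
have [s hs es] : exists2 s, 0 <= s <= h & g (p + h *: u) - g p = h * 'D_u g (p + s *: u).
  apply: (@mvt_line g) => // s hs; apply: differentiableB; [exact: dsh|exact: df0].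
have [t ht et] : exists2 t, 0 <= t <= h &
    'D_u f (p + s *: u + h *: v) - 'D_u f (p + s *: u)
    = h * 'D_v (fun y => 'D_u f y) (p + s *: u + t *: v).
  apply: (@mvt_line (fun y => 'D_u f y)) => // t ht.
  exact: (hd s t hs ht).2.
exists s, t; split=> //; rewrite -et.
have -> : 'D_u f (p + s *: u + h *: v) - 'D_u f (p + s *: u) = 'D_u g (p + s *: u).
  rewrite /g deriveB; [|exact/diff_derivable/dsh|exact/diff_derivable/df0].
  by rewrite derive_shift_arg.
by rewrite -es /g opprB addrA -!addrA; congr (_ + (_ + _)); rewrite addrC.
Qed.

(** The second difference is symmetric in [u] and [v], so the two mixed derivatives take the same
    value at two points near [x], possibly different ones; their continuity at [x] closes the
    gap. *)
Lemma schwarz_real f U x u v : open U -> smooth_on U f -> U x ->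
  'D_u (fun y => 'D_v f y) x = 'D_v (fun y => 'D_u f y) x.
Proof.
move=> oU hf Ux.
have cont a b : {for x, continuous (fun y => 'D_a (fun z => 'D_b f z) y)}.
  exact: (smooth_on_derive a (smooth_on_derive b hf) 0%N x Ux).
apply/eqP; rewrite -subr_eq0 -normr_le0; apply/ler_addgt0Pr => e e0; rewrite add0r.
have e2 : 0 < e / 2 by rewrite divr_gt0.
have /cvgrPdist_lt /(_ _ e2) c1 := cont u v.
have /cvgrPdist_lt /(_ _ e2) c2 := cont v u.
have oUx : nbhs x U by exact: open_nbhs_nbhs.
have [d d0 hd] := (nbhs_ballP _ _).1 (filterI oUx (filterI c1 c2)).
rewrite /= in d0.
(* The step h = d/(2N) keeps x + su + tv within d/2 of x whenever s and t lie in [0, h]; the summand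
   1 makes N positive. *)
pose N := `|u| + `|v| + 1.
have N0 : 0 < N by rewrite ltr_wpDl // addr_ge0.
pose h := d / N / 2.
have h0 : 0 < h by rewrite !divr_gt0.
have inb a b s t : `|a| + `|b| + 1 = N -> 0 <= s <= h -> 0 <= t <= h ->
    ball x d (x + s *: a + t *: b).
  move=> eN /andP[s0 sh] /andP[t0 th]; rewrite -ball_normE /ball_ /=.
  rewrite -addrA opprD addNKr normrN (le_lt_trans (ler_normD _ _)) // !normrZ !ger0_norm //.
  apply: (@le_lt_trans _ _ (h * N)).
    rewrite -eN mulrDr mulrDr mulr1 -[leLHS]addr0 lerD ?(ltW h0) // lerD // ler_wpM2r //.
  have -> : h * N = d / 2 by rewrite /h; field; rewrite gt_eqF.
  by rewrite ltr_pdivrMr // mulr_natr mulr2n ltrDl.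
have key a b : `|a| + `|b| + 1 = N -> exists s t, [/\ 0 <= s <= h, 0 <= t <= h &
    f (x + h *: a + h *: b) - f (x + h *: a) - f (x + h *: b) + f x
    = h * (h * 'D_b (fun y => 'D_a f y) (x + s *: a + t *: b))].
  move=> eN; apply: second_difference => // s t hs ht.
  have [Uy _] := hd _ (inb a b s t eN hs ht).
  split; first exact: smooth_on_differentiable hf Uy.
  exact: smooth_on_differentiable (smooth_on_derive a hf) Uy.
have eN : `|u| + `|v| + 1 = N by [].
have eN' : `|v| + `|u| + 1 = N by rewrite /N (addrC `|u|).
have [s [t [hs ht est]]] := key u v eN.
have [s' [t' [hs' ht' est']]] := key v u eN'.
have e12 : 'D_v (fun y => 'D_u f y) (x + s *: u + t *: v)
         = 'D_u (fun y => 'D_v f y) (x + s' *: v + t' *: u).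
  apply: (mulfI (lt0r_neq0 h0)); apply: (mulfI (lt0r_neq0 h0)).
  apply: (etrans (esym est)); apply: (etrans _ est').
  rewrite (addrAC x (h *: v) (h *: u)); congr (_ + f x); exact: addrAC.
have [_ [_ /= n2]] := hd _ (inb u v s t eN hs ht).
have [_ [/= n1 _]] := hd _ (inb v u s' t' eN' hs' ht').
rewrite e12 in n2.
exact: (ler_dist_half n1 n2).
Qed.

Lemma schwarz p q (f : V -> 'M[R]_(p, q)) U x u v : open U -> smooth_on U f -> U x ->
  'D_u (fun y => 'D_v f y) x = 'D_v (fun y => 'D_u f y) x.
Proof.
move=> oU hf Ux; apply/matrixP => i j.
have hD a := smooth_on_differentiable (smooth_on_derive a hf) Ux.
have e a b : 'D_a (fun y => ('D_b f y) i j) x = 'D_a (fun y => 'D_b (fun z => f z i j) y) x.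
  apply: near_eq_derive; have := open_nbhs_nbhs (conj oU Ux); apply: filterS => y Uy.
  by rewrite derive_coord //; exact: smooth_on_differentiable hf Uy.
have h1 := derive_coord u i j (hD v).
have h2 := derive_coord v i j (hD u).
have h3 := smooth_on_coord i j oU hf.
have h4 := e u v.
have h5 := e v u.
apply: (etrans (esym h1)).
apply: (etrans h4).
apply: (etrans _ h2).
apply: (etrans _ (esym h5)).
apply: (schwarz_real u v oU _ Ux).
exact: h3.
Qed.

End schwarz.
(** * The exterior derivative *)

Section ext_d.
Context (R : realType) (V : normedModType R).

Lemma ext_d_nil (W : normedModType R) (eta : V -> seq V -> W) x : ext_d eta x [::] = 0.
Proof. by rewrite /ext_d big_ord0. Qed.

(** Cartan's formula for a constant vector field, whose Lie derivative is the directional derivative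
    ['D_v]. *)
Lemma ext_d_cons (W : normedModType R) (eta : V -> seq V -> W) x v s :
  ext_d eta x (v :: s)
  = 'D_v (fun y => eta y s) x - ext_d (fun y => contract v (eta y)) x s.
Proof.
rewrite /ext_d /= big_ord_recl /= expr0 scale1r drop0; congr (_ + _).
rewrite -sumrN; apply: eq_bigr => i _; rewrite /bump /= exprS mulN1r scaleNr.
by congr (- (_ *: _)).
Qed.

Definition diff_family (W : normedModType R) (x : V) (eta : V -> seq V -> W) :=
  forall s, differentiable (fun y => eta y s) x.

Lemma diff_family_contract (W : normedModType R) x v (eta : V -> seq V -> W) :
  diff_family x eta -> diff_family x (fun y => contract v (eta y)).
Proof. by move=> h s; exact: (h (v :: s)). Qed.

Lemma diff_family_grade_inv (W : normedModType R) x (a : V -> seq V -> W) :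
  diff_family x a -> diff_family x (fun y => grade_inv (a y)).
Proof. by move=> ha s; exact: (differentiableZ _ (ha s)). Qed.

Lemma eq_ext_d (W : normedModType R) (a b : V -> seq V -> W) x s :
  (\near x, a x = b x) -> ext_d a x s = ext_d b x s.
Proof.
move=> ab; apply: eq_bigr => i _; congr (_ *: _); apply: near_eq_derive.
by apply: filterS ab => y ->.
Qed.

Lemma deriveZ_fun (W : normedModType R) c (a : V -> W) x v : differentiable a x ->
  'D_v (fun y => c *: a y) x = c *: 'D_v a x.
Proof. by move=> da; apply: deriveZ; exact/diff_derivable. Qed.

Lemma derive_lin (W : normedModType R) c (a b : V -> W) x v :
  differentiable a x -> differentiable b x ->
  'D_v (fun y => c *: a y + b y) x = c *: 'D_v a x + 'D_v b x.
Proof.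
move=> da db.
have -> : (fun y => c *: a y + b y) = c \*: a + b by [].
rewrite deriveD; [|exact/derivableZ/diff_derivable|exact/diff_derivable].
by rewrite deriveZ //; exact/diff_derivable.
Qed.

Lemma differentiable_sum_fun (W : normedModType R) (I : Type) (r : seq I)
  (F : I -> V -> W) x :
  (forall i, differentiable (F i) x) -> differentiable (fun y => \sum_(i <- r) F i y) x.
Proof.
move=> hF; elim: r => [|i r IH].
  have -> : (fun y => \sum_(i <- [::]) F i y) = cst 0.
    by apply/funext => y; rewrite big_nil.
  exact: differentiable_cst.
have -> : (fun y => \sum_(j <- i :: r) F j y) = F i + (fun y => \sum_(j <- r) F j y).
  by apply/funext => y; rewrite big_cons.
exact: differentiableD.
Qed.

Lemma derive_sum_fun (W : normedModType R) (I : Type) (r : seq I) (F : I -> V -> W) x v :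
  (forall i, differentiable (F i) x) ->
  'D_v (fun y => \sum_(i <- r) F i y) x = \sum_(i <- r) 'D_v (F i) x.
Proof.
move=> hF; elim: r => [|i r IH].
  have -> : (fun y => \sum_(i <- [::]) F i y) = cst 0.
    by apply/funext => y; rewrite big_nil.
  by rewrite big_nil derive_cst.
have -> : (fun y => \sum_(j <- i :: r) F j y) = F i + (fun y => \sum_(j <- r) F j y).
  by apply/funext => y; rewrite big_cons.
rewrite big_cons -IH; apply: deriveD; first exact/diff_derivable.
exact/diff_derivable/differentiable_sum_fun.
Qed.

Lemma ext_d_lin (W : normedModType R) c (a b : V -> seq V -> W) x s :
  diff_family x a -> diff_family x b ->
  ext_d (fun y s => c *: a y s + b y s) x s = c *: ext_d a x s + ext_d b x s.
Proof.
move=> ha hb; rewrite /ext_d scaler_sumr -big_split; apply: eq_bigr => i _ /=.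
by rewrite derive_lin // scalerDr !scalerA mulrC.
Qed.

Lemma ext_dD (W : normedModType R) (a b : V -> seq V -> W) x s :
  diff_family x a -> diff_family x b ->
  ext_d (fun y s => a y s + b y s) x s = ext_d a x s + ext_d b x s.
Proof.
move=> ha hb; rewrite -[X in X + _]scale1r -(ext_d_lin _ _ ha hb).
have -> // : (fun y s => 1 *: a y s + b y s) = (fun y s => a y s + b y s).
by apply/funext => y; apply/funext => t; rewrite scale1r.
Qed.

Lemma ext_d_sum (W : normedModType R) n (F : 'I_n -> V -> seq V -> W) x s :
  (forall i, diff_family x (F i)) ->
  ext_d (fun y s => \sum_i F i y s) x s = \sum_i ext_d (F i) x s.
Proof.
move=> hF; rewrite /ext_d exchange_big; apply: eq_bigr => i _ /=.
rewrite derive_sum_fun ?scaler_sumr => // j; exact: hF.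
Qed.

Lemma ext_dZ (W : normedModType R) c (a : V -> seq V -> W) x s :
  diff_family x a -> ext_d (fun y s => c *: a y s) x s = c *: ext_d a x s.
Proof.
move=> ha; rewrite /ext_d scaler_sumr; apply: eq_bigr => i _ /=.
have -> : 'D_(nth 0 s i) (fun y => c *: a y (take i s ++ drop i.+1 s)) x
   = c *: 'D_(nth 0 s i) (fun y => a y (take i s ++ drop i.+1 s)) x.
  exact: deriveZ_fun.
by rewrite !scalerA mulrC.
Qed.

Lemma ext_d0 (W : normedModType R) x s : ext_d (fun (_ : V) (_ : seq V) => 0 : W) x s = 0.
Proof. by rewrite /ext_d big1 // => i _; rewrite derive_cst scaler0. Qed.

Section wedge.
Context (W1 W2 W3 : normedModType R) (op : W1 -> W2 -> W3).
Hypothesis hop : leibniz V op.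
Let hb := leibniz_bilin hop.

Lemma diff_family_wedge x (al : V -> seq V -> W1) (be : V -> seq V -> W2) :
  diff_family x al -> diff_family x be ->
  diff_family x (fun y => wedge op (al y) (be y)).
Proof.
move=> ha hbe s; rewrite /wedge; apply: differentiable_sum_fun => m.
apply: differentiableZ; case: hop => _ _ h.
by have [] := h _ _ x (ha (mask m s)) (hbe (mask (map negb m) s)).
Qed.

Lemma smooth_on_wedge U (al : V -> seq V -> W1) (be : V -> seq V -> W2) : open U ->
  (forall s, smooth_on U (fun y => al y s)) -> (forall s, smooth_on U (fun y => be y s)) ->
  forall s, smooth_on U (fun y => wedge op (al y) (be y) s).
Proof.
move=> oU ha hbe s; apply: smooth_on_sum => // m; apply: smooth_onZ => //.
exact: smooth_on_leibniz.
Qed.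

Lemma derive_wedge x (al : V -> seq V -> W1) (be : V -> seq V -> W2) v s :
  diff_family x al -> diff_family x be ->
  'D_v (fun y => wedge op (al y) (be y) s) x
  = wedge op (fun t => 'D_v (fun y => al y t) x) (be x) s
    + wedge op (al x) (fun t => 'D_v (fun y => be y t) x) s.
Proof.
elim: s al be => [|u s IH] al be ha hbe.
  rewrite !wedge_nil //.
  have -> : (fun y => wedge op (al y) (be y) [::]) = (fun y => op (al y [::]) (be y [::])).
    by apply/funext => y; rewrite wedge_nil.
  by rewrite (leibniz_derive hop).
have -> : (fun y => wedge op (al y) (be y) (u :: s))
   = (fun y => 1 *: wedge op (contract u (al y)) (be y) s
       + wedge op (grade_inv (al y)) (contract u (be y)) s).
  by apply/funext => y; rewrite wedge_cons // scale1r.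
have hga := diff_family_grade_inv ha.
have hca := diff_family_contract u ha.
have hcb := diff_family_contract u hbe.
rewrite (derive_lin _ _ (diff_family_wedge hca hbe s) (diff_family_wedge hga hcb s)).
rewrite scale1r !IH // !wedge_cons //.
have -> : (fun t => 'D_v (fun y => grade_inv (al y) t) x)
    = grade_inv (fun t => 'D_v (fun y => al y t) x).
  by apply/funext => t; exact: deriveZ_fun (ha t).
exact: addrACA.
Qed.

(** After one insertion, Cartan's formula on the left and the antiderivation rule on the right leave
    the same six terms, by induction. *)
Lemma ext_d_wedge x (al : V -> seq V -> W1) (be : V -> seq V -> W2) s :
  diff_family x al -> diff_family x be ->
  ext_d (fun y => wedge op (al y) (be y)) x s
  = wedge op (ext_d al x) (be x) s + wedge op (grade_inv (al x)) (ext_d be x) s.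
Proof.
elim: s al be => [|v s IH] al be ha hbe.
  by rewrite !wedge_nil // /grade_inv !ext_d_nil (bilin0l hb) (bilin0r hb) addr0.
have hga := diff_family_grade_inv ha.
have hca := diff_family_contract v ha.
have hcb := diff_family_contract v hbe.
rewrite ext_d_cons derive_wedge //.
have -> : (fun y => contract v (wedge op (al y) (be y)))
   = (fun y t => wedge op (contract v (al y)) (be y) t
       + wedge op (grade_inv (al y)) (contract v (be y)) t).
  by apply/funext => y; apply/funext => t; rewrite /contract wedge_cons.
rewrite (ext_dD _ (diff_family_wedge hca hbe) (diff_family_wedge hga hcb)).
rewrite !IH // !wedge_cons //.
have -> : contract v (ext_d al x) = (fun t => 'D_v (fun y => al y t) x
    + (-1) *: ext_d (fun y => contract v (al y)) x t).
  by apply/funext => t; rewrite scaleN1r; exact: ext_d_cons.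
have -> : contract v (ext_d be x) = (fun t => 'D_v (fun y => be y t) x
    + (-1) *: ext_d (fun y => contract v (be y)) x t).
  by apply/funext => t; rewrite scaleN1r; exact: ext_d_cons.
(* The exterior derivative raises degrees by one, hence anticommutes with the grading involution. *)
have -> : grade_inv (ext_d al x) = (fun t => -1 *: ext_d (fun y => grade_inv (al y)) x t).
  apply/funext => t; rewrite /grade_inv /ext_d !scaler_sumr; apply: eq_bigr => i _.
  have -> : 'D_(nth 0 t i) (fun y => (-1) ^+ size (take i t ++ drop i.+1 t)
        *: al y (take i t ++ drop i.+1 t)) x
     = (-1) ^+ size (take i t ++ drop i.+1 t)
        *: 'D_(nth 0 t i) (fun y => al y (take i t ++ drop i.+1 t)) x.
    exact: deriveZ_fun.
  have e : size t = (size (take i t ++ drop i.+1 t)).+1.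
    rewrite size_cat size_take size_drop ltn_ord; have := ltn_ord i; lia.
  rewrite {1}e exprS mulN1r scaleNr scaleN1r !scalerA; congr (- (_ *: _)).
  by rewrite mulrC.
have -> : contract v (grade_inv (al x)) = (fun t => -1 *: grade_inv (contract v (al x)) t).
  by rewrite contract_grade_inv; apply/funext => t; rewrite scaleN1r.
have -> : grade_inv (grade_inv (al x)) = al x.
  by apply/funext => t; rewrite /grade_inv scalerA -expr2 sqrr_sign scale1r.
rewrite (wedgeDl hb) (wedgeDr hb) !(wedgeZl hb) (wedgeZr hb) !scaleN1r.
set a1 := wedge _ _ _ _; set a2 := wedge _ _ _ _; set a3 := wedge _ _ _ _.
set a4 := wedge _ _ _ _; set a5 := wedge _ _ _ _; set a6 := wedge _ _ _ _.
rewrite !opprD !addrA; congr (_ - a6).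
rewrite (addrAC _ (- a4) a2) (addrAC _ (- a5) a2) (addrAC _ (- a3) a2).
exact: addrAC.
Qed.

End wedge.

Lemma smooth_on_ext_d (W : normedModType R) U (eta : V -> seq V -> W) s : open U ->
  (forall s, smooth_on U (fun y => eta y s)) -> smooth_on U (fun y => ext_d eta y s).
Proof.
move=> oU h; apply: smooth_on_sum => // i; apply: smooth_onZ => //.
exact: smooth_on_derive.
Qed.

Lemma smooth_on_diff_family (W : normedModType R) U (eta : V -> seq V -> W) x :
  (forall s, smooth_on U (fun y => eta y s)) -> U x -> diff_family x eta.
Proof. by move=> h Ux s; exact: smooth_on_differentiable (h s) Ux. Qed.

Lemma ext_d_derive p q U (eta : V -> seq V -> 'M[R]_(p, q)) x v s : open U ->
  (forall s, smooth_on U (fun y => eta y s)) -> U x ->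
  ext_d (fun y t => 'D_v (fun z => eta z t) y) x s = 'D_v (fun y => ext_d eta y s) x.
Proof.
move=> oU h Ux; rewrite /ext_d derive_sum_fun => [|i]; last first.
  apply: differentiableZ; exact: smooth_on_differentiable (smooth_on_derive _ (h _)) Ux.
apply: eq_bigr => i _.
have hs := h (take i s ++ drop i.+1 s).
rewrite (deriveZ_fun _ _ (smooth_on_differentiable (smooth_on_derive _ hs) Ux)).
by rewrite (schwarz _ _ oU hs Ux).
Qed.

(** Inserting [v] and using Cartan's formula twice gives D_v d - d D_v + d d i_v. The first two
    terms cancel by [ext_d_derive], and the induction covers the last. *)
Lemma ext_d_ext_d p q U (eta : V -> seq V -> 'M[R]_(p, q)) x s : open U ->
  (forall s, smooth_on U (fun y => eta y s)) -> U x ->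
  ext_d (ext_d eta) x s = 0.
Proof.
move=> oU; elim: s eta => [|v s IH] eta h Ux; first exact: ext_d_nil.
have hc t : smooth_on U (fun y => contract v (eta y) t) by exact: h.
rewrite ext_d_cons.
have -> : (fun y => contract v (ext_d eta y))
   = (fun y t => (-1) *: ext_d (fun z => contract v (eta z)) y t
                 + 'D_v (fun z => eta z t) y).
  apply/funext => y; apply/funext => t; rewrite scaleN1r addrC.
  exact: ext_d_cons.
have d1 : diff_family x (ext_d (fun z => contract v (eta z))).
  apply: (smooth_on_diff_family (U := U)) => // t; exact: smooth_on_ext_d.
have d2 : diff_family x (fun y t => 'D_v (fun z => eta z t) y).
  apply: (smooth_on_diff_family (U := U)) => // t; exact: smooth_on_derive.
rewrite (ext_d_lin _ _ d1 d2) IH // scaler0 add0r.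
by rewrite (ext_d_derive _ _ oU h Ux) subrr.
Qed.

Lemma alternating_ext_d (W : normedModType R) k (eta : V -> seq V -> W) x :
  (forall y, alternating k (eta y)) -> diff_family x eta -> alternating k.+1 (ext_d eta x).
Proof.
move=> ha hd.
have hl y := alternating_linear (ha y); have hv y := alternating_adjacent (ha y).
apply: alternatingP.
- move=> s hs; rewrite /ext_d big1 // => i _.
  have -> : (fun y => eta y (take i s ++ drop i.+1 s)) = cst 0.
    apply/funext => y; apply: (alternating_hom (ha y)).
    apply: contra hs => /eqP <-; rewrite size_cat size_take size_drop ltn_ord.
    by rewrite -addSn subnKC // ltn_ord.
  by rewrite derive_cst scaler0.
- move=> s1; elim: s1 eta {ha hv} hl hd => [|w s1 IH] eta hl hd s2 c u v /=.
    rewrite !ext_d_cons.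
    have -> : (fun y => contract (c *: u + v) (eta y))
      = (fun y t => c *: contract u (eta y) t + contract v (eta y) t).
      by apply/funext => y; apply/funext => t; exact: slot_linear_cons.
    rewrite (ext_d_lin _ _ (diff_family_contract u hd) (diff_family_contract v hd)).
    (* Linearity in the direction of differentiation comes from the full differential. *)
    rewrite !(deriveE _ (hd s2)) linearD linearZ scalerBr opprD addrACA.
    by [].
  rewrite !ext_d_cons.
  have -> : (fun y => eta y (s1 ++ (c *: u + v) :: s2))
     = (fun y => c *: eta y (s1 ++ u :: s2) + eta y (s1 ++ v :: s2)).
    by apply/funext => y; exact: hl.
  rewrite (derive_lin _ _ (hd _) (hd _)).
  rewrite IH; [|by move=> y; exact: slot_linear_contract|exact: diff_family_contract].
  by rewrite scalerBr opprD addrACA.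
- move=> s1; elim: s1 eta {ha hl} hv hd => [|w s1 IH] eta hv hd s2 u /=.
    (* Cartan's formula twice: the derivative along [u] of the value at [u :: s2] appears with both
       signs. *)
    rewrite ext_d_cons ext_d_cons.
    have -> : (fun y => contract u (contract u (eta y))) = (fun _ _ => 0).
      by apply/funext => y; apply/funext => t; exact: (hv y [::]).
    by rewrite ext_d0 subr0; exact: subrr.
  rewrite ext_d_cons.
  have -> : (fun y => eta y (s1 ++ [:: u, u & s2])) = cst 0.
    by apply/funext => y; exact: hv.
  rewrite IH; [|by move=> y; exact: adjacent_vanish_contract|exact: diff_family_contract].
  by rewrite derive_cst subrr.
Qed.

(** Functions become 0-forms so that the Leibniz rule for [wedge] also governs products with
    Jacobian entries and gluing matrices. *)
Definition form0 (W : normedModType R) (g : V -> W) : V -> seq V -> W := fun y s =>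
  if s is [::] then g y else 0.

Lemma ext_d_form0 (W : normedModType R) (g : V -> W) x v s :
  ext_d (form0 g) x (v :: s) = form0 (fun y => 'D_v g y) x s.
Proof.
rewrite ext_d_cons.
have -> : (fun y => contract v (form0 g y)) = (fun _ _ => 0) by [].
rewrite ext_d0 subr0; case: s => //= u s; exact: derive_cst.
Qed.

Lemma diff_family_form0 (W : normedModType R) (g : V -> W) x :
  differentiable g x -> diff_family x (form0 g).
Proof. by move=> dg [|u s] //=; exact: differentiable_cst. Qed.

Lemma wedge_form0 (W1 W2 W3 : normedModType R) (op : W1 -> W2 -> W3)
  (g : V -> W1) (be : seq V -> W2) x s : bilin op ->
  wedge op (form0 g x) be s = op (g x) (be s).
Proof. by move=> hb; rewrite (wedge_deg0 hb) // => -[]. Qed.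

End ext_d.

(** * Naturality of the exterior derivative under pullback *)

Section pullback.
Context (R : realType) (V : normedModType R) (m : nat) (W : normedModType R).
Context (U : set V) (tau : V -> 'rV[R]_m) (x : V).
Hypotheses (oU : open U) (htau : smooth_on U tau) (Ux : U x).

Definition pullback_form (W : Type) (zeta : 'rV[R]_m -> seq 'rV[R]_m -> W) :
  V -> seq V -> W := fun y s => zeta (tau y) [seq 'D_v tau y | v <- s].

Local Notation e := (delta_mx 0).
Local Notation J u y l := ('D_u tau y 0 l).

Let dtau : differentiable tau x := smooth_on_differentiable htau Ux.
Let smoothJ u l : smooth_on U (fun y => J u y l : R^o).
Proof. exact: smooth_on_coord oU (smooth_on_derive u htau). Qed.
Let dJ u l : differentiable (fun y => J u y l : R^o) x.
Proof. exact: smooth_on_differentiable (smoothJ u l) Ux. Qed.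

(** In other words, the 1-forms d tau_l are closed. *)
Let JC u v l : 'D_v (fun y => J u y l : R^o) x = 'D_u (fun y => J v y l : R^o) x.
Proof.
have h a b : 'D_a (fun y => J b y l : R^o) x = 'D_a (fun y => 'D_b tau y) x 0 l.
  apply: derive_coord; exact: smooth_on_differentiable (smooth_on_derive b htau) Ux.
by apply: (etrans (h v u)); apply: (etrans _ (esym (h u v))); rewrite (schwarz u v oU htau Ux).
Qed.

(** The inserted vector ['D_u tau y] moves with [y]. Expanding it in the standard basis leaves fixed
    vectors to contract with and puts the motion into the Jacobian coefficients. *)
Lemma pullback_cons (zeta : 'rV[R]_m -> seq 'rV[R]_m -> W) :
  (forall z, slot_linear (zeta z)) -> forall y u s,
  pullback_form zeta y (u :: s)
  = \sum_l J u y l *: pullback_form (fun z => contract (e l) (zeta z)) y s.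
Proof.
move=> hl y u s; rewrite /pullback_form /= [X in zeta _ (X :: _)]row_sum_delta.
by rewrite slot_linear_sum.
Qed.

Lemma diff_family_pullback (zeta : 'rV[R]_m -> seq 'rV[R]_m -> W) :
  (forall z, slot_linear (zeta z)) -> diff_family (tau x) zeta ->
  diff_family x (pullback_form zeta).
Proof.
move=> hl hd s; elim: s zeta hl hd => [|u s IH] zeta hl hd.
  exact: (differentiable_comp dtau (hd [::])).
have -> : (fun y => pullback_form zeta y (u :: s))
   = (fun y => \sum_l J u y l *: pullback_form (fun z => contract (e l) (zeta z)) y s).
  by apply/funext => y; rewrite pullback_cons.
apply: differentiable_sum_fun => l.
have hIH := IH (fun z => contract (e l) (zeta z))
  (fun z => slot_linear_contract (e l) (hl z)) (diff_family_contract (e l) hd).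
by have [] := differentiable_scale (dJ u l) hIH.
Qed.

(* The sum is cancelled by the other terms of [ext_d_pullback]; it involves the
   second derivatives of [tau], whose symmetry drives the induction. *)
Lemma derive_pullback (zeta : 'rV[R]_m -> seq 'rV[R]_m -> W) v s :
  (forall z, slot_linear (zeta z)) -> (forall z, adjacent_vanish (zeta z)) ->
  diff_family (tau x) zeta ->
  'D_v (fun y => pullback_form zeta y s) x
  = 'D_('D_v tau x) (fun z => zeta z [seq 'D_u tau x | u <- s]) (tau x)
    + \sum_l wedge *:%R (ext_d (form0 (fun y => J v y l : R^o)) x)
         (pullback_form (fun z => contract (e l) (zeta z)) x) s.
Proof.
have hb := @bilin_scale R W.
elim: s zeta => [|u s IH] zeta hl hv hd.
  rewrite big1 ?addr0 => [|l _]; last by rewrite wedge_nil ext_d_nil scale0r.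
  rewrite (deriveE _ (differentiable_comp dtau (hd [::]))).
  rewrite (diff_comp dtau (hd [::])) (deriveE _ (hd [::])) (deriveE _ dtau).
  by [].
pose z_ l := fun z => contract (e l) (zeta z).
have hl_ l z : slot_linear (z_ l z) by exact: slot_linear_contract.
have hv_ l z : adjacent_vanish (z_ l z) by exact: adjacent_vanish_contract.
have hd_ l : diff_family (tau x) (z_ l) by exact: diff_family_contract.
have hp_ l := diff_family_pullback (hl_ l) (hd_ l).
have -> : (fun y => pullback_form zeta y (u :: s))
   = (fun y => \sum_l J u y l *: pullback_form (z_ l) y s).
  by apply/funext => y; rewrite pullback_cons.
rewrite derive_sum_fun => [|l]; last by have [] := differentiable_scale (dJ u l) (hp_ l s).
under eq_bigr => l _.
  have [_ ->] := differentiable_scale (dJ u l) (hp_ l s).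
  rewrite (IH _ (hl_ l) (hv_ l) (hd_ l)) scalerDr; over.
rewrite !big_split /=.
have -> : 'D_('D_v tau x) (fun z => zeta z ('D_u tau x :: [seq 'D_u tau x | u <- s])) (tau x)
   = \sum_l J u x l *: 'D_('D_v tau x) (fun z => z_ l z [seq 'D_u tau x | u <- s]) (tau x).
  have -> : (fun z => zeta z ('D_u tau x :: [seq 'D_u tau x | u <- s]))
     = (fun z => \sum_l J u x l *: z_ l z [seq 'D_u tau x | u <- s]).
    apply/funext => z; rewrite [X in zeta _ (X :: _)]row_sum_delta.
    by rewrite slot_linear_sum.
  rewrite derive_sum_fun => [|l]; last exact: differentiableZ (hd_ l _).
  by apply: eq_bigr => l _; rewrite deriveZ_fun //; exact: (hd_ l).
rewrite addrCA; congr (_ + _).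
have hF l : grade_inv (ext_d (form0 (fun y => J v y l : R^o)) x)
   = fun t => (-1) *: ext_d (form0 (fun y => J v y l : R^o)) x t.
  apply/funext => -[|a [|b t]]; rewrite /grade_inv ?ext_d_nil ?scaler0 //.
  by rewrite ext_d_form0 !scaler0.
under [RHS]eq_bigr => l _.
  rewrite (wedge_cons hb) hF (wedgeZl hb).
  have -> : contract u (ext_d (form0 (fun y => J v y l : R^o)) x)
     = form0 (fun y => 'D_u (fun y => J v y l : R^o) y) x.
    by apply/funext => t; exact: ext_d_form0.
  rewrite (wedge_form0 _ _ _ _ hb) (JC v u).
  have -> : contract u (pullback_form (z_ l) x)
      = fun t => \sum_k (- J u x k) *: pullback_form (fun z => contract (e l) (z_ k z)) x t.
    apply/funext => t; rewrite [LHS](pullback_cons (hl_ l)); apply: eq_bigr => k _.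
    rewrite scaleNr -scalerN; congr (_ *: _).
    exact: (@swap_adjacent _ _ _ _ [::] _ _ _ (hl _) (hv _)).
  rewrite (wedge_sumr hb) scaler_sumr.
  under [X in _ + X]eq_bigr => k _ do rewrite (wedgeZr hb) scalerA mulrN mulN1r opprK.
  over.
rewrite big_split /=; congr (_ + _).
under eq_bigr => l _ do rewrite scaler_sumr.
exact: exchange_big.
Qed.

(** After inserting [v], the Leibniz rule produces the differentials of the Jacobian entries, which
    cancel the correction term of [derive_pullback]. What remains is Cartan's formula on the target,
    by induction. *)
Lemma ext_d_pullback (zeta : 'rV[R]_m -> seq 'rV[R]_m -> W) s :
  (forall z, slot_linear (zeta z)) -> (forall z, adjacent_vanish (zeta z)) ->
  diff_family (tau x) zeta ->
  ext_d (pullback_form zeta) x s = pullback_form (ext_d zeta) x s.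
Proof.
have hb := @bilin_scale R W.
elim: s zeta => [|v s IH] zeta hl hv hd; first by rewrite /pullback_form /= !ext_d_nil.
pose z_ l := fun z => contract (e l) (zeta z).
have hl_ l z : slot_linear (z_ l z) by exact: slot_linear_contract.
have hv_ l z : adjacent_vanish (z_ l z) by exact: adjacent_vanish_contract.
have hd_ l : diff_family (tau x) (z_ l) by exact: diff_family_contract.
have hp_ l := diff_family_pullback (hl_ l) (hd_ l).
have hJ l := diff_family_form0 (dJ v l).
have hw l := diff_family_wedge (leibniz_scale V W) (hJ l) (hp_ l).
rewrite [LHS]ext_d_cons (derive_pullback _ _ hl hv hd).
have -> : (fun y => contract v (pullback_form zeta y))
   = (fun y t => \sum_l wedge *:%R (form0 (fun y => J v y l : R^o) y) (pullback_form (z_ l) y) t).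
  apply/funext => y; apply/funext => t; rewrite [LHS](pullback_cons hl).
  by apply: eq_bigr => l _; rewrite wedge_form0.
rewrite (ext_d_sum _ hw).
under [X in _ - X]eq_bigr => l _.
  rewrite (ext_d_wedge (leibniz_scale V W) _ (hJ l) (hp_ l)).
  have -> : grade_inv (form0 (fun y => J v y l : R^o) x) = form0 (fun y => J v y l : R^o) x.
    by apply/funext => -[|a t]; rewrite /grade_inv /= ?expr0 ?scale1r ?scaler0.
  rewrite (wedge_form0 _ _ _ _ hb) (IH _ (hl_ l) (hv_ l) (hd_ l)).
  over.
rewrite big_split /= opprD addrA addrK /pullback_form /= ext_d_cons; congr (_ - _).
have -> : (fun z => contract ('D_v tau x) (zeta z)) = (fun z t => \sum_l J v x l *: z_ l z t).
  apply/funext => z; apply/funext => t; rewrite /contract [X in zeta _ (X :: _)]row_sum_delta.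
  by rewrite slot_linear_sum.
rewrite ext_d_sum => [|l t]; last exact: differentiableZ (hd_ l t).
by apply: eq_bigr => l _; rewrite (ext_dZ _ _ (hd_ l)).
Qed.

End pullback.
(** * Forms with values in a vector bundle *)

Section manifold.
Context (R : realType) (m : nat) (M : manifold R m).
Implicit Types a b : chart_index M.

Lemma open_codom a : open (codom a). Proof. exact: codom_open. Qed.

Lemma overlap_codom a b x : overlap a b x -> codom a x.
Proof. by case=> p [pa pb] <-; exists p. Qed.

Lemma param_overlap a b x : overlap a b x -> dom a (param a x) /\ dom b (param a x).
Proof. by case=> p [pa pb] <-; rewrite chartK. Qed.

Lemma transition_codom a b x : overlap a b x -> codom b (transition a b x).
Proof. by move=> /param_overlap[_ pb]; exists (param a x). Qed.

Lemma open_overlap a b : open (overlap a b).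
Proof.
have -> : overlap a b = codom a `&` (param a @^-1` dom b).
  apply/seteqP; split=> [x xab|x [[p pa <-]]] /=.
    by split; [exact: overlap_codom xab|have [] := param_overlap xab].
  by rewrite chartK // => pb; exists p.
rewrite openE => x [ax bx]; apply: filterI.
  apply: open_nbhs_nbhs; split=> //; exact: open_codom.
apply: param_continuous ax _ _; apply: open_nbhs_nbhs; split=> //; exact: dom_open.
Qed.

Lemma smooth_on_transition a b : smooth_on (overlap a b) (transition a b).
Proof. exact: transition_smooth. Qed.

Context (r : nat) (E : vector_bundle M r).

Lemma gluing_unit a b x : overlap a b x -> gluing E a b (param a x) \in unitmx.
Proof.
move=> /param_overlap[pa pb].
have /mulmx1_unit[] // : gluing E a b (param a x) *m gluing E b a (param a x) = 1%:M.
by rewrite gluing_cocycle // gluing_id.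
Qed.

Lemma E_form0 k : is_E_form E k (0 : forms M 'cV[R]_r).
Proof.
split=> //; first by move=> a x; exact: alternating0.
  by move=> a s; exact: smooth_on_cst.
by move=> *; rewrite mulmx0.
Qed.

Lemma E_form_lin k c (f g : forms M 'cV[R]_r) : is_E_form E k f -> is_E_form E k g ->
  is_E_form E k (fun a x s => c *: f a x s + g a x s).
Proof.
move=> [f1 f2 f3 f4] [g1 g2 g3 g4]; split.
- by move=> a x s ax; rewrite f1 // g1 // scaler0 addr0.
- by move=> a x; exact: alternating_lin.
- move=> a s; apply: smooth_onD; [exact: open_codom| |exact: g3].
  by apply: smooth_onZ; [exact: open_codom|exact: f3].
- by move=> a b x s xab; rewrite (f4 a b) // (g4 a b) // mulmxDr scalemxAr.
Qed.

Lemma E_formB k (f g : forms M 'cV[R]_r) : is_E_form E k f -> is_E_form E k g ->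
  is_E_form E k (f - g).
Proof.
move=> hf hg; have := E_form_lin (-1) hg hf.
congr is_form; apply/funext => a; apply/funext => x; apply/funext => s.
by rewrite scaleN1r addrC.
Qed.

Lemma E_formZ k c (f : forms M 'cV[R]_r) : is_E_form E k f ->
  is_E_form E k (fun a x s => c *: f a x s).
Proof.
move=> hf; have := E_form_lin c hf (E_form0 k).
congr is_form; apply/funext => a; apply/funext => x; apply/funext => s.
exact: addr0.
Qed.

Lemma E_form_diff_family k (f : forms M 'cV[R]_r) a x : is_E_form E k f -> codom a x ->
  diff_family x (f a).
Proof. by move=> hf; apply: smooth_on_diff_family => s; exact: form_smooth hf a s. Qed.

Lemma E_form_off k (f : forms M 'cV[R]_r) a x : is_E_form E k f -> ~ codom a x ->
  f a x = fun=> 0.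
Proof. by move=> hf ax; apply/funext => s; exact: form_support hf _ _ _ ax. Qed.

(** Forms are extended by zero, so an identity between them can be checked inside each chart. *)
Lemma E_form_eq k (f g : forms M 'cV[R]_r) : is_E_form E k f -> is_E_form E k g ->
  (forall a x, codom a x -> f a x = g a x) -> f = g.
Proof.
move=> hf hg h; apply/funext => a; apply/funext => x.
have [ax|ax] := pselect (codom a x); first exact: h.
by rewrite (E_form_off hf ax) (E_form_off hg ax).
Qed.

(** * The covariant derivative of bundle-valued forms *)

Section connection.
Context (A : forms M 'M[R]_r) (hA : is_connection E A).

Lemma connection_diff_family a x : codom a x -> diff_family x (A a).
Proof. apply: smooth_on_diff_family => s; exact: connection_smooth hA a s. Qed.

Lemma dA_codom (eta : forms M 'cV[R]_r) a x : codom a x ->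
  dA A eta a x = fun s => ext_d (eta a) x s + wedge mulmx (A a x) (eta a x) s.
Proof. by move=> ax; apply/funext => s; rewrite /dA asboolT. Qed.

(** The transition law of the connection as an identity of matrix-valued forms, ready to be wedged
    with a section; only lists of length one carry content. *)
Lemma connection_gluing a b x s : overlap a b x ->
  ext_d (form0 (fun y => gluing E a b (param a y))) x s
  + wedge mulmx (A a x) (form0 (fun y => gluing E a b (param a y)) x) s
  = wedge mulmx (form0 (fun y => gluing E a b (param a y)) x)
      (pullback_form (transition a b) (A b) x) s.
Proof.
move=> xab; have hb := @bilin_mulmx R r r r.
have hAa := connection_alternating hA (overlap_codom xab).
have hAb := connection_alternating hA (transition_codom xab).
rewrite (wedge_form0 _ _ _ _ hb) /pullback_form.
case: s => [|v [|u s]].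
- rewrite ext_d_nil wedge_nil add0r (alternating_hom hAa) // (alternating_hom hAb) //.
  by rewrite mul0mx mulmx0.
- rewrite ext_d_form0 (wedge_cons hb) !wedge_nil /= mulmx0 addr0 addrC.
  exact: connection_transition.
- rewrite ext_d_form0 /= add0r (alternating_hom hAb) // mulmx0.
  apply: (wedge_hom hb (p := 1) (q := 0) (alternating_hom hAa)) => //.
  by case.
Qed.

Lemma E_form_pullback k (eta : forms M 'cV[R]_r) a b x : is_E_form E k eta ->
  overlap a b x ->
  eta a x = wedge mulmx (form0 (fun y => gluing E a b (param a y)) x)
              (pullback_form (transition a b) (eta b) x).
Proof.
move=> h xab; apply/funext => s; rewrite (wedge_form0 _ _ _ _ (@bilin_mulmx R r r 1)).
exact: form_transition h a b x s xab.
Qed.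

(** Write [g] for the gluing and [tau] for the transition. As eta_a is g times the pullback of
    eta_b, the Leibniz rule produces dg + A_a g acting on that pullback, and [connection_gluing]
    turns it into g times the pullback of A_b. The other term is handled by [ext_d_pullback]. *)
Lemma E_form_dA k (eta : forms M 'cV[R]_r) : is_E_form E k eta -> is_E_form E k.+1 (dA A eta).
Proof.
move=> h; have hb := @bilin_mulmx R r r 1; split.
- by move=> a x s ax; rewrite /dA asboolF.
- move=> a x; have [ax|ax] := pselect (codom a x); last first.
    have -> : dA A eta a x = fun=> 0 by apply/funext => s; rewrite /dA asboolF.
    exact: alternating0.
  rewrite dA_codom //.
  have -> : (fun s => ext_d (eta a) x s + wedge mulmx (A a x) (eta a x) s)
     = (fun s => 1 *: ext_d (eta a) x s + wedge mulmx (A a x) (eta a x) s).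
    by apply/funext => s; rewrite scale1r.
  apply: alternating_lin.
    apply: alternating_ext_d; last exact: E_form_diff_family h ax.
    exact: form_alternating h a.
  exact: (alternating_wedge hb (connection_alternating hA ax) (form_alternating h a x)).
- move=> a s; have oU : open (codom a) by exact: open_codom.
  have h1 := smooth_on_ext_d s oU (form_smooth h a).
  have h2 := smooth_on_wedge (leibniz_mulmx _ r r 1) oU (connection_smooth hA a)
    (form_smooth h a) s.
  apply: smooth_on_ext (smooth_onD oU h1 h2) => // x ax.
  by rewrite dA_codom.
- move=> a b x s xab; have ax := overlap_codom xab; have bx := transition_codom xab.
  have oU : open (overlap a b) by exact: open_overlap.
  set g := fun y => gluing E a b (param a y).
  have dg : diff_family x (form0 g).
    apply: diff_family_form0; exact: smooth_on_differentiable (gluing_smooth E a b) xab.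
  have hl z := alternating_linear (form_alternating h b z).
  have hv z := alternating_adjacent (form_alternating h b z).
  have hd := E_form_diff_family h bx.
  have dp := diff_family_pullback oU (smooth_on_transition a b) xab hl hd.
  have lm := leibniz_mulmx ('rV[R]_m) r r 1.
  rewrite !dA_codom //.
  (* A derivative sees a neighbourhood of [x], so the transition law is used on the whole open
     overlap. *)
  have -> : ext_d (eta a) x s
     = ext_d (fun y => wedge mulmx (form0 g y) (pullback_form (transition a b) (eta b) y)) x s.
    apply: eq_ext_d; apply: filterS (open_nbhs_nbhs (conj oU xab)) => y yab.
    exact: E_form_pullback h yab.
  rewrite (ext_d_wedge lm _ dg dp) (E_form_pullback h xab) -/g.
  have -> : grade_inv (form0 g x) = form0 g x.
    by apply/funext => -[|v t]; rewrite /grade_inv /= ?expr0 ?scale1r ?scaler0.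
  rewrite -(wedgeA _ _ _ _ (@bilin_mulmx R r r r) hb hb hb); last first.
    by move=> *; rewrite mulmxA.
  rewrite addrAC -(wedgeDl hb).
  have -> : (fun t => ext_d (form0 g) x t + wedge mulmx (A a x) (form0 g x) t)
    = wedge mulmx (form0 g x) (pullback_form (transition a b) (A b) x).
    by apply/funext => t; exact: connection_gluing.
  rewrite (wedgeA _ _ _ _ (@bilin_mulmx R r r r) hb hb hb); last first.
    by move=> *; rewrite mulmxA.
  rewrite -(wedgeDr hb) (wedge_form0 _ _ _ _ hb) /pullback_form; congr (_ *m _).
  rewrite addrC; congr (_ + _); last by rewrite wedge_map.
  exact: (ext_d_pullback oU (smooth_on_transition a b) xab).
Qed.

Lemma dA_lin k c (f g : forms M 'cV[R]_r) : is_E_form E k f -> is_E_form E k g ->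
  dA A (fun a x s => c *: f a x s + g a x s)
  = fun a x s => c *: dA A f a x s + dA A g a x s.
Proof.
move=> hf hg; apply: (E_form_eq (E_form_dA (E_form_lin c hf hg))
  (E_form_lin c (E_form_dA hf) (E_form_dA hg))) => a x ax.
apply/funext => s; rewrite !dA_codom //.
rewrite (ext_d_lin _ _ (E_form_diff_family hf ax) (E_form_diff_family hg ax)).
by rewrite (wedge_linr (@bilin_mulmx R r r 1)) scalerDr addrACA.
Qed.

Lemma dAB k (f g : forms M 'cV[R]_r) : is_E_form E k f -> is_E_form E k g ->
  dA A (f - g) = dA A f - dA A g.
Proof.
move=> hf hg; have e : forall f g : forms M 'cV[R]_r,
    f - g = fun a x s => (-1) *: g a x s + f a x s.
  move=> f' g'; apply/funext => a; apply/funext => x; apply/funext => s.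
  by rewrite scaleN1r addrC.
by rewrite (e f g) (dA_lin (-1) hg hf) e.
Qed.

End connection.


(** * Commutation of the covariant derivative with L and Phi, and its square *)

Lemma E_form_lef (w : forms M R) k (eta : forms M 'cV[R]_r) : is_real_form 2 w ->
  is_E_form E k eta -> is_E_form E k.+2 (lef w eta).
Proof.
move=> hw h; have hb := @bilin_scale R 'cV[R]_r; split.
- by move=> a x s ax; rewrite /lef (E_form_off h ax) (wedge0r hb).
- move=> a x; exact: (alternating_wedge hb (form_alternating hw a x) (form_alternating h a x)).
- move=> a s; have oU : open (codom a) by exact: open_codom.
  exact: (smooth_on_wedge (leibniz_scale _ _) oU (form_smooth hw a) (form_smooth h a) s).
- move=> a b x s xab; rewrite /lef wedge_map.
  rewrite (wedge_morph (op' := *:%R) (g1 := id) (g2 := mulmx (gluing E a b (param a x)))).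
    congr (wedge _ _ _ s); apply/funext => t; first exact: form_transition hw a b x t xab.
    exact: form_transition h a b x t xab.
  by move=> c v; rewrite scalemxAr.
Qed.

(** [w] is closed and of even degree, so both [ext_d] and the connection form pass it without a
    sign. *)
Lemma dA_lef (w : forms M R) (A : forms M 'M[R]_r) k (eta : forms M 'cV[R]_r) :
  symplectic w -> is_connection E A -> is_E_form E k eta ->
  dA A (lef w eta) = lef w (dA A eta).
Proof.
move=> [hw hc _] hA h.
apply: (E_form_eq (E_form_dA hA (E_form_lef hw h)) (E_form_lef hw (E_form_dA hA h))) => a x ax.
have hs := @bilin_scale R 'cV[R]_r.
have hm := @bilin_mulmx R r r 1.
have hs1 := @bilin_scale R 'M[R]_r.
have hs2 := @bilin_scaler R 'M[R]_r.
apply/funext => s; rewrite dA_codom // /lef dA_codom //.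
have dw : diff_family x (w a).
  by apply: smooth_on_diff_family ax => t; exact: form_smooth hw a t.
rewrite (ext_d_wedge (leibniz_scale _ _) _ dw (E_form_diff_family h ax)).
have -> : ext_d (w a) x = fun=> 0 by apply/funext => t; exact: hc.
rewrite (wedge0l hs) add0r.
rewrite (grade_inv_parity (alternating_parity (form_alternating hw a x))) /= expr0.
have -> : (fun t => 1 *: w a x t) = w a x by apply/funext => t; rewrite scale1r.
rewrite (wedgeDr hs); congr (_ + _).
rewrite -(wedgeA _ _ _ _ hs2 hm hs hm); last by move=> *; rewrite -scalemxAl scalemxAr.
have -> : wedge (fun Y c => c *: Y) (A a x) (w a x) = wedge *:%R (w a x) (A a x).
  apply/funext => t.
  rewrite (wedgeC _ hs2 hs1 _ (alternating_parity (connection_alternating hA ax))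
    (alternating_parity (form_alternating hw a x))) //=.
  by rewrite expr0 scale1r.
by rewrite (wedgeA _ _ _ _ hs1 hm hm hs) // => *; rewrite scalemxAl.
Qed.

Lemma act_EndE (Psi : forms M 'M[R]_r) (eta : forms M 'cV[R]_r) a x s :
  is_End_form E 0 Psi -> act_End Psi eta a x s = Psi a x [::] *m eta a x s.
Proof.
move=> hP; apply: (wedge_deg0 (@bilin_mulmx R r r 1)).
exact: (alternating_hom (form_alternating hP a x)).
Qed.

Lemma E_form_act_End (Psi : forms M 'M[R]_r) k (eta : forms M 'cV[R]_r) :
  is_End_form E 0 Psi -> is_E_form E k eta -> is_E_form E k (act_End Psi eta).
Proof.
move=> hP h; have hb := @bilin_mulmx R r r 1; split.
- by move=> a x s ax; rewrite /act_End (E_form_off h ax) (wedge0r hb).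
- by move=> a x; exact: (alternating_wedge hb (form_alternating hP a x) (form_alternating h a x)).
- move=> a s; have oU : open (codom a) by exact: open_codom.
  exact: (smooth_on_wedge (leibniz_mulmx _ r r 1) oU (form_smooth hP a) (form_smooth h a) s).
- move=> a b x s xab; rewrite !act_EndE // (form_transition h _ xab) (form_transition hP _ xab) /=.
  by rewrite -!mulmxA (mulKmx (gluing_unit xab)).
Qed.

Lemma lef_act_End (w : forms M R) (Psi : forms M 'M[R]_r) (eta : forms M 'cV[R]_r) :
  is_End_form E 0 Psi -> lef w (act_End Psi eta) = act_End Psi (lef w eta).
Proof.
move=> hP; apply/funext => a; apply/funext => x; apply/funext => s.
rewrite act_EndE // /lef.
rewrite (wedge_morph (op' := *:%R) (g1 := id) (g2 := mulmx (Psi a x [::]))).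
  by congr (wedge _ _ _ s); apply/funext => t; rewrite act_EndE.
by move=> c v; rewrite scalemxAr.
Qed.

(** The two products of the connection form with d eta cancel and d d eta = 0, which leaves the
    curvature acting on eta. *)
Lemma dA_dA (w : forms M R) (A Phi : forms M 'M[R]_r) k (eta : forms M 'cV[R]_r) :
  symplectic w -> is_connection E A -> symplectically_flat E w A Phi ->
  is_E_form E k eta -> dA A (dA A eta) = act_End Phi (lef w eta).
Proof.
move=> [hw _ _] hA [hP hF _] h.
apply: (E_form_eq (E_form_dA hA (E_form_dA hA h)) (E_form_act_End hP (E_form_lef hw h))).
move=> a x ax; apply/funext => s.
have hm := @bilin_mulmx R r r 1.
have hmm := @bilin_mulmx R r r r.
have hs := @bilin_scale R 'cV[R]_r.
have hs2 := @bilin_scaler R 'M[R]_r.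
have oU : open (codom a) by exact: open_codom.
have dA_ := connection_diff_family hA ax.
have de := E_form_diff_family h ax.
have lm := leibniz_mulmx ('rV[R]_m) r r 1.
rewrite (dA_codom A (dA A eta) ax) (dA_codom A eta ax).
have -> : ext_d (dA A eta a) x s
   = ext_d (fun y t => ext_d (eta a) y t + wedge mulmx (A a y) (eta a y) t) x s.
  apply: eq_ext_d; apply: filterS (open_nbhs_nbhs (conj oU ax)) => y ay.
  exact: dA_codom.
rewrite ext_dD; last first.
- exact: diff_family_wedge.
- apply: (smooth_on_diff_family (U := codom a)) => // t.
  exact: smooth_on_ext_d oU (form_smooth h a).
rewrite (ext_d_ext_d _ oU (form_smooth h a) ax) add0r.
rewrite (ext_d_wedge lm _ dA_ de) (wedgeDr hm).
rewrite (grade_inv_parity (alternating_parity (connection_alternating hA ax))) /= expr1.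
rewrite (wedgeZl hm) scaleN1r addrA subrK.
rewrite -(wedgeA _ _ _ _ hmm hm hm hm) => [|*]; last by rewrite mulmxA.
rewrite -(wedgeDl hm).
have -> : (fun t => ext_d (A a) x t + wedge mulmx (A a x) (A a x) t)
  = wedge (fun Y c => c *: Y) (Phi a x) (w a x).
  by apply/funext => t; exact: hF.
by rewrite (wedgeA _ _ _ _ hs2 hm hs hm) // => *; rewrite -scalemxAl scalemxAr.
Qed.

(** Since [Phi] is parallel, d Phi + A Phi = Phi A, which absorbs the extra Leibniz term. *)
Lemma dA_act_End (w : forms M R) (A Phi : forms M 'M[R]_r) k (eta : forms M 'cV[R]_r) :
  is_connection E A -> symplectically_flat E w A Phi ->
  is_E_form E k eta -> dA A (act_End Phi eta) = act_End Phi (dA A eta).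
Proof.
move=> hA [hP _ hc] h.
apply: (E_form_eq (E_form_dA hA (E_form_act_End hP h)) (E_form_act_End hP (E_form_dA hA h))).
move=> a x ax; apply/funext => s.
have hm := @bilin_mulmx R r r 1.
have hmm := @bilin_mulmx R r r r.
have de := E_form_diff_family h ax.
have lm := leibniz_mulmx ('rV[R]_m) r r 1.
have dP : diff_family x (Phi a).
  by apply: smooth_on_diff_family ax => t; exact: form_smooth hP a t.
rewrite (dA_codom A (act_End Phi eta) ax) /act_End (dA_codom A eta ax) (ext_d_wedge lm _ dP de).
rewrite (grade_inv_parity (alternating_parity (form_alternating hP a x))) /= expr0.
have -> : (fun t => 1 *: Phi a x t) = Phi a x by apply/funext => t; rewrite scale1r.
rewrite (wedgeDr hm) addrAC [RHS]addrC; congr (_ + _).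
rewrite -(wedgeA _ _ _ _ hmm hm hm hm) => [|*]; last by rewrite mulmxA.
rewrite -(wedgeA _ _ _ _ hmm hm hm hm) => [|*]; last by rewrite mulmxA.
rewrite -(wedgeDl hm); congr (wedge _ _ _ s); apply/funext => t.
by apply/eqP; rewrite -subr_eq0; apply/eqP; exact: hc.
Qed.

(** * The inverse of the curvature endomorphism *)

(** Zero off the codomains and on non-empty lists, as the support and degree conditions on a 0-form
    demand. *)
Definition inv_End (Phi : forms M 'M[R]_r) : forms M 'M[R]_r := fun a x s =>
  if `[< codom a x >] then (if s is [::] then invmx (Phi a x [::]) else 0) else 0.

(** Smoothness is Cramer's rule; the transition law holds because inverses of conjugate matrices are
    conjugate. *)
Lemma End_form_inv (Phi : forms M 'M[R]_r) : invertible Phi -> is_End_form E 0 Phi ->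
  is_End_form E 0 (inv_End Phi).
Proof.
move=> hi hP; split.
- by move=> a x s ax; rewrite /inv_End asboolF.
- move=> a x; apply: alternatingP.
  + by move=> [|v s] //= _; rewrite /inv_End; case: asbool.
  + by move=> [|v s1] s2 c u u'; rewrite /inv_End /=; case: asbool; rewrite scaler0 addr0.
  + by move=> [|v s1] s2 u; rewrite /inv_End /=; case: asbool.
- move=> a s; have oU : open (codom a) by exact: open_codom.
  case: s => [|v s].
    apply: (smooth_on_ext oU _ (smooth_on_invmx oU _ (form_smooth hP a [::]))) => x ax.
      by rewrite /inv_End asboolT.
    exact: hi.
  apply: (smooth_on_ext oU _ (@smooth_on_cst _ _ _ _ 0)) => x ax.
  by rewrite /inv_End; case: asbool.
- move=> a b x s xab; rewrite /inv_End !asboolT; last 2 first.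
  + exact: transition_codom xab.
  + exact: overlap_codom xab.
  have gu := gluing_unit xab.
  case: s => [|v s] /=; last by rewrite mulmx0 mul0mx.
  have Pu := hi _ _ (transition_codom xab).
  rewrite (form_transition hP [::] xab) /=.
  set G := gluing E a b _ in gu *; set P := Phi b _ _ in Pu *.
  have hu : G *m P *m invmx G \in unitmx by rewrite !unitmx_mul gu Pu unitmx_inv gu.
  apply: (can_inj (mulKmx hu)); rewrite mulmxV //.
  by rewrite -!mulmxA (mulKmx gu) (mulKVmx Pu) mulmxV.
Qed.

Lemma act_End_inv (Phi : forms M 'M[R]_r) k (eta : forms M 'cV[R]_r) :
  invertible Phi -> is_End_form E 0 Phi -> is_E_form E k eta ->
  act_End Phi (act_End (inv_End Phi) eta) = eta.
Proof.
move=> hi hP h; have hQ := End_form_inv hi hP.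
apply: (E_form_eq (E_form_act_End hP (E_form_act_End hQ h)) h) => a x ax.
apply/funext => s; rewrite !act_EndE // /inv_End asboolT // mulmxA mulmxV ?mul1mx //.
exact: hi.
Qed.

Lemma act_End_invK (Phi : forms M 'M[R]_r) k (eta : forms M 'cV[R]_r) :
  invertible Phi -> is_End_form E 0 Phi -> is_E_form E k eta ->
  act_End (inv_End Phi) (act_End Phi eta) = eta.
Proof.
move=> hi hP h; have hQ := End_form_inv hi hP.
apply: (E_form_eq (E_form_act_End hQ (E_form_act_End hP h)) h) => a x ax.
apply/funext => s; rewrite !act_EndE // /inv_End asboolT // mulmxA mulVmx ?mul1mx //.
exact: hi.
Qed.

(** Obtained by cancelling [Phi] in [dA_act_End], without a formula for the derivative of an inverse
    matrix. *)
Lemma dA_act_inv (w : forms M R) (A Phi : forms M 'M[R]_r) k (eta : forms M 'cV[R]_r) :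
  is_connection E A -> symplectically_flat E w A Phi -> invertible Phi ->
  is_E_form E k eta ->
  dA A (act_End (inv_End Phi) eta) = act_End (inv_End Phi) (dA A eta).
Proof.
move=> hA hF hi h; have hP := flat_Phi hF; have hQ := End_form_inv hi hP.
have hq := E_form_act_End hQ h.
rewrite -[LHS](act_End_invK hi hP (E_form_dA hA hq)) -(dA_act_End hA hF hq).
by rewrite (act_End_inv hi hP h).
Qed.

End manifold.
(** * The Lefschetz decomposition of a covariant derivative *)

Section symplectic_manifold.
Context (R : realType) (n : nat) (M : manifold R n.*2) (r : nat).
Context (w : forms M R) (E : vector_bundle M r) (hw : symplectic w).
Implicit Types a b : chart_index M.

Let hw2 : is_real_form 2 w. Proof. exact: symplectic_form hw. Qed.

(** A row vector killed by the Gram matrix pairs to zero with every basis vector, hence with every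
    vector, against nondegeneracy. *)
Lemma gram_unit_codom a x : codom a x -> gram (w a x) \in unitmx.
Proof.
move=> ax; rewrite unitmxE unitfE; apply/det0P => -[u u0 hu].
have hl := alternating_linear (form_alternating hw2 a x).
move/eqP: u0; apply; apply: (symplectic_nondegenerate hw ax) => v.
rewrite [u]row_sum_delta [v]row_sum_delta (slot_linear_sum _ _ _ hl).
under eq_bigr => i _.
  rewrite [w a x _](slot_linear_sum (fun j => v 0 j) (fun j => delta_mx 0 j) [::]
    (slot_linear_contract (delta_mx 0 i) hl)) scaler_sumr.
  under eq_bigr => j _ do rewrite scalerA mulrC -scalerA.
  over.
rewrite exchange_big /= big1 // => j _; rewrite -scaler_sumr.
have -> : \sum_i u 0 i *: w a x [:: delta_mx 0 i; delta_mx 0 j] = (u *m gram (w a x)) 0 j.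
  by rewrite mxE; apply: eq_bigr => i _; rewrite mxE.
by rewrite hu mxE scaler0.
Qed.

Definition Lam (eta : forms M 'cV[R]_r) : forms M 'cV[R]_r :=
  fun a x => Lam_at (w a x) (eta a x).

Lemma smooth_on_gram a : smooth_on (codom a) (fun x => gram (w a x)).
Proof.
have oU : open (codom a) by exact: open_codom.
apply: smooth_on_mx => // i j.
by apply: (smooth_on_ext oU _ (form_smooth hw2 a [:: delta_mx 0 i; delta_mx 0 j])) => x _; rewrite mxE.
Qed.

Section transition.
Context (a b : chart_index M) (x : 'rV[R]_n.*2) (xab : overlap a b x).
(** Transpose of the usual Jacobian: tangent vectors are rows, so [J] acts on them from the
    right. *)
Let J : 'M[R]_n.*2 := \matrix_(i, k) 'D_(delta_mx 0 i) (transition a b) x 0 k.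
Let y := transition a b x.

Let JE i : 'D_(delta_mx 0 i) (transition a b) x = \sum_k J i k *: delta_mx 0 k.
Proof. by rewrite [LHS]row_sum_delta; apply: eq_bigr => k _; rewrite mxE. Qed.

Let expand (V : lmodType R) (f : seq 'rV[R]_n.*2 -> V) i j s : slot_linear f ->
  f ('D_(delta_mx 0 i) (transition a b) x :: 'D_(delta_mx 0 j) (transition a b) x :: s)
  = \sum_k \sum_l (J i k * J j l) *: f (delta_mx 0 k :: delta_mx 0 l :: s).
Proof.
move=> hl; rewrite JE JE (slot_linear_sum _ _ _ hl); apply: eq_bigr => k _.
rewrite [f _](slot_linear_sum _ _ _ (slot_linear_contract (delta_mx 0 k) hl)).
by rewrite scaler_sumr; apply: eq_bigr => l _; rewrite scalerA.
Qed.

Let gramE : gram (w a x) = J *m gram (w b y) *m J^T.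
Proof.
apply/matrixP => i j; rewrite !mxE (form_transition hw2 _ xab) /=.
rewrite (expand _ _ _ (alternating_linear (form_alternating hw2 b y))).
rewrite exchange_big; apply: eq_bigr => l _ /=; rewrite !mxE mulr_suml.
by apply: eq_bigr => k _; rewrite !mxE /GRing.scale /= mulrAC.
Qed.

(** The inverse bivector transforms contravariantly. Invertibility of [J] is read off from that of
    the Gram matrix in which it is a factor. *)
Let inv_gramE : J^T *m invmx (gram (w a x)) *m J = invmx (gram (w b y)).
Proof.
have Ga := gram_unit_codom (overlap_codom xab).
have Gb := gram_unit_codom (transition_codom xab).
have := Ga; rewrite {1}gramE !unitmx_mul => /andP[/andP[Ju _] JTu].
apply: (can_inj (mulmxK Gb)); rewrite mulVmx // -!mulmxA.
have -> : J *m gram (w b y) = gram (w a x) *m invmx J^T by rewrite gramE mulmxK.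
by rewrite (mulKmx Ga) mulmxV.
Qed.

(** Both sides are expanded on the basis vectors of the chart [b], where [inv_gramE] matches the
    coefficients. *)
Lemma Lam_transition k (eta : forms M 'cV[R]_r) s : is_E_form E k eta ->
  Lam eta a x s = gluing E a b (param a x) *m
    Lam eta b y [seq 'D_v (transition a b) x | v <- s].
Proof.
move=> h; rewrite /Lam /Lam_at /dual_contract.
have hl := alternating_linear (form_alternating h b y).
set t := [seq _ | _ <- _].
pose f i j := eta b y (delta_mx 0 i :: delta_mx 0 j :: t).
pose P := invmx (gram (w a x)).
pose c : R := - 2^-1.
have -> : \sum_i \sum_j (c *: invmx (gram (w b y))) i j *: f i j
   = \sum_k \sum_l \sum_i \sum_j (c * P i j * (J i k * J j l)) *: f k l.
  apply: eq_bigr => k' _; apply: eq_bigr => l _.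
  rewrite -inv_gramE !mxE mulr_sumr scaler_suml exchange_big; apply: eq_bigr => j _ /=.
  rewrite !mxE -scaler_suml; congr (_ *: _).
  by rewrite mulr_suml mulr_sumr; apply: eq_bigr => i _; rewrite !mxE; ring.
transitivity (gluing E a b (param a x) *m
    \sum_i \sum_j \sum_k \sum_l (c * P i j * (J i k * J j l)) *: f k l).
  rewrite mulmx_sumr; apply: eq_bigr => i _; rewrite mulmx_sumr; apply: eq_bigr => j _.
  rewrite (form_transition h _ xab) /= (expand _ _ _ hl) scalemxAr mxE; congr (_ *m _).
  rewrite scaler_sumr; apply: eq_bigr => k' _; rewrite scaler_sumr; apply: eq_bigr => l _.
  by rewrite scalerA.
congr (_ *m _).
under eq_bigr => i _ do rewrite exchange_big.
rewrite exchange_big; apply: eq_bigr => k' _ /=.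
under eq_bigr => i _ do rewrite exchange_big.
exact: exchange_big.
Qed.

End transition.

Lemma E_form_Lam k (eta : forms M 'cV[R]_r) : is_E_form E k eta -> is_E_form E k.-2 (Lam eta).
Proof.
move=> h; split.
- move=> a x s ax; rewrite /Lam (E_form_off h ax) /Lam_at /dual_contract.
  by rewrite big1 // => i _; rewrite big1 // => j _; rewrite scaler0.
- move=> a x; exact/alternating_dual_contract/(form_alternating h).
- move=> a s; have oU : open (codom a) by exact: open_codom.
  apply: smooth_on_sum => // i; apply: smooth_on_sum => // j.
  apply: smooth_on_scale; [exact: oU| |exact: (form_smooth h a)].
  have hi := smooth_on_coord i j oU (smooth_on_invmx oU (@gram_unit_codom a) (smooth_on_gram a)).
  apply: (smooth_on_ext oU _ (@smooth_onZ _ _ R^o _ (- 2^-1) _ oU hi)) => x _.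
  by rewrite mxE.
- move=> a b x s xab; exact: Lam_transition h.
Qed.

(** * The sl2 results at a point of a chart *)

Section pointwise.
Context (a : chart_index M) (x : 'rV[R]_n.*2) (ax : codom a x).
Let X := seq 'rV[R]_n.*2 -> 'cV[R]_r.
Let D (k : nat) (f : X) := alternating k f.
Let L : X -> X := lef_at (w a x).
Let La : X -> X := Lam_at (w a x).

Let Dlin k c f g : D k f -> D k g -> D k (c *: f + g). Proof. exact: alternating_lin. Qed.
Let DL k f : D k f -> D k.+2 (L f).
Proof. exact: (alternating_wedge (@bilin_scale R _) (form_alternating hw2 a x)). Qed.
Let DLam k f : D k.+2 f -> D k (La f).
Proof. exact: (@alternating_dual_contract _ _ _ _ k.+2). Qed.
Let Lam0 f : D 0%N f -> La f = 0. Proof. by move=> h; exact: dual_contract_low h _. Qed.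
Let Lam1 f : D 1%N f -> La f = 0. Proof. by move=> h; exact: dual_contract_low h _. Qed.
Let Llin c f g : L (c *: f + g) = c *: L f + L g. Proof. exact: lef_at_lin. Qed.
Let Lamlin c f g : La (c *: f + g) = c *: La f + La g. Proof. exact: Lam_at_lin. Qed.
Let LamL k f : D k f -> La (L f) = L (La f) + (n%:R - k%:R) *: f.
Proof. exact: (LamL_at (form_alternating hw2 a x) (gram_unit_codom ax)). Qed.

Definition prim_at k (f : X) := prim n D L k f.

Lemma lef_quot_prim_at k f : (k <= n)%N -> alternating k.+1 f ->
  iter (n - k).+1 L f = 0 -> (0 < k)%N -> prim_at k.-1 (lef_quot n La k f).
Proof. exact: (lef_quot_prim Dlin DL DLam Llin Lamlin LamL). Qed.

Lemma lef_rem_prim_at k f : (k <= n)%N -> alternating k.+1 f ->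
  iter (n - k).+1 L f = 0 -> (k < n)%N -> prim_at k.+1 (lef_rem n L La k f).
Proof. exact: (lef_rem_prim Dlin DL DLam Lam1 Llin Lamlin LamL). Qed.

Lemma lef_rem_top_at k f : (k <= n)%N -> alternating k.+1 f ->
  iter (n - k).+1 L f = 0 -> k = n -> lef_rem n L La k f = 0.
Proof. exact: (lef_rem_top DL Llin Lamlin LamL). Qed.

Lemma lef_quot_deg0_at k f : alternating k.+1 f -> k = 0%N -> lef_quot n La k f = 0.
Proof. exact: (lef_quot_deg0 n Lam1). Qed.

Lemma lef_inj_at k f : (k <= n)%N -> alternating k f -> iter (n - k) L f = 0 -> f = 0.
Proof. exact: (lef_inj DL DLam Lam0 Lam1 Llin Lamlin LamL). Qed.

Lemma lefschetz_unique_at N K (b : nat -> X) :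
  (forall i, (i < N)%N -> b i = 0 \/ (prim_at (K - i.*2) (b i) /\ (i <= n - (K - i.*2))%N)) ->
  \sum_(i < N) iter i L (b i) = 0 -> forall i, (i < N)%N -> b i = 0.
Proof. exact: (lefschetz_unique DL DLam Lam0 Lam1 Llin Lamlin LamL). Qed.

End pointwise.

Lemma iter_lefE j (eta : forms M 'cV[R]_r) a x :
  iter j (lef w) eta a x = iter j (lef_at (w a x)) (eta a x).
Proof. by elim: j => //= j IH; rewrite {1}/lef IH. Qed.

Lemma primitive_at k (beta : forms M 'cV[R]_r) a x : primitive E w k beta ->
  prim_at a x k (beta a x).
Proof.
move=> [kn h h0]; split=> //; first exact: form_alternating h a x.
by rewrite -iter_lefE h0.
Qed.

Lemma iter_lef_zero j a x : iter j (lef_at (w a x)) (0 : seq 'rV[R]_n.*2 -> 'cV[R]_r) = 0.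
Proof. apply: iter_lef0; exact: lef_at_lin. Qed.

Lemma primitive_intro k (beta : forms M 'cV[R]_r) : (k <= n)%N -> is_E_form E k beta ->
  (forall a x, codom a x -> prim_at a x k (beta a x)) -> primitive E w k beta.
Proof.
move=> kn h h0; split=> //; apply/funext => a; apply/funext => x; rewrite iter_lefE.
have [ax|ax] := pselect (codom a x); first by have [] := h0 a x ax.
by rewrite (E_form_off h ax); exact: iter_lef_zero.
Qed.

Lemma primitive0 k : (k <= n)%N -> primitive E w k 0.
Proof.
move=> kn; apply: primitive_intro => //; first exact: E_form0.
by move=> a x _; split=> //; [exact: alternating0|exact: iter_lef_zero].
Qed.

Lemma primitiveB k (f g : forms M 'cV[R]_r) : primitive E w k f -> primitive E w k g ->
  primitive E w k (f - g).
Proof.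
move=> [kn hf f0] [_ hg g0]; have hfg := E_formB hf hg.
apply: primitive_intro => // a x _; split=> //; first exact: form_alternating hfg a x.
have e : (f - g) a x = (-1) *: g a x + f a x.
  by apply/funext => s; rewrite [RHS]addrC scaleN1r.
have hL := @lef_at_lin R n r (w a x).
rewrite e (iter_lefD hL) (iter_lefZ hL) -!iter_lefE f0 g0.
by rewrite scaler0 addr0.
Qed.

Lemma lefD_forms (f g : forms M 'cV[R]_r) : lef w (f + g) = lef w f + lef w g.
Proof.
apply/funext => a; apply/funext => x; apply/funext => s.
exact: (wedgeDr (@bilin_scale R 'cV[R]_r)).
Qed.

Lemma lefN_forms (f : forms M 'cV[R]_r) : lef w (- f) = - lef w f.
Proof.
apply/funext => a; apply/funext => x; apply/funext => s.
rewrite -[RHS]scaleN1r -(wedgeZr (@bilin_scale R 'cV[R]_r)).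
by congr (wedge _ _ _ s); apply/funext => t; rewrite scaleN1r.
Qed.

Lemma iter_lef_forms0 j : iter j (lef w) (0 : forms M 'cV[R]_r) = 0.
Proof.
apply/funext => a; apply/funext => x; rewrite iter_lefE; exact: iter_lef_zero.
Qed.

Lemma lef_forms0 : lef w (0 : forms M 'cV[R]_r) = 0.
Proof. exact: (iter_lef_forms0 1). Qed.

Lemma iter_lefB_forms j (f g : forms M 'cV[R]_r) :
  iter j (lef w) (f - g) = iter j (lef w) f - iter j (lef w) g.
Proof. by elim: j => //= j ->; rewrite lefD_forms lefN_forms. Qed.

(** The difference of two decompositions decomposes 0, so the pointwise uniqueness applies in every
    chart. *)
Lemma lefschetz_decomposition_unique K (eta : forms M 'cV[R]_r) be1 be2 :
  lefschetz_decomposition E w K eta be1 -> lefschetz_decomposition E w K eta be2 -> be1 = be2.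
Proof.
move=> [p1 z1 e1] [p2 z2 e2]; apply/funext => i.
have [hi|hi] := boolP (K - n <= i <= K./2)%N; last by rewrite z1 // z2.
have hd j : (K - n <= j <= K./2)%N -> primitive E w (K - j.*2) (be1 j - be2 j).
  by move=> hj; apply: primitiveB; [exact: p1|exact: p2].
apply/eqP; rewrite -subr_eq0; apply/eqP.
have [_ hf _] := hd i hi.
apply: (E_form_eq hf (E_form0 E _)) => a x ax.
apply: (@lefschetz_unique_at a x ax K./2.+1 K (fun j => (be1 j - be2 j) a x)) => [j hj||].
- have [hj'|hj'] := boolP (K - n <= j <= K./2)%N; last by left; rewrite z1 // z2 // subr0.
  right; split; first exact/primitive_at/hd.
  (* The lower bound K - n <= j is the same as j <= n - (K - 2j), the condition of the pointwise
     lemma. *)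
  by have := hj'; have := odd_double_half K; lia.
- have hs : \sum_(j < K./2.+1) iter j (lef w) (be1 j - be2 j) = 0.
    under eq_bigr => j _ do rewrite iter_lefB_forms.
    by rewrite sumrB -e1 -e2 subrr.
  have ev (m : nat) (F : 'I_m -> forms M 'cV[R]_r) : (\sum_j F j) a x = \sum_j F j a x.
    by elim: (index_enum _) => [|j l IH]; rewrite ?big_nil ?big_cons // -IH.
  rewrite -[RHS]/((0 : forms M 'cV[R]_r) a x) -hs ev.
  by apply: eq_bigr => j _; rewrite iter_lefE.
- by case/andP: hi.
Qed.

(** Makes the choice in [lefschetz] harmless: any exhibited decomposition is the chosen one. *)
Lemma lefschetz_eq K (eta : forms M 'cV[R]_r) be :
  lefschetz_decomposition E w K eta be -> lefschetz E w K eta = be.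
Proof.
move=> hb; apply: xget_unique => // be' hb'; exact: lefschetz_decomposition_unique hb' hb.
Qed.

End symplectic_manifold.
(** * Exactness of the twisted primitive complex *)

Section complex.
Context (R : realType) (n r : nat) (M : manifold R n.*2).
Context (w : forms M R) (E : vector_bundle M r) (A Phi : forms M 'M[R]_r).
Hypotheses (hw : symplectic w) (hA : is_connection E A).
Hypotheses (hflat : symplectically_flat E w A Phi) (hinv : invertible Phi).
Implicit Types f g beta gamma : forms M 'cV[R]_r.

Let hw2 : is_real_form 2 w. Proof. exact: symplectic_form hw. Qed.
Let hPhi : is_End_form E 0 Phi. Proof. exact: flat_Phi hflat. Qed.
Let Psi := inv_End Phi.
Let hPsi : is_End_form E 0 Psi. Proof. exact: End_form_inv. Qed.

Lemma primitive_form k beta : primitive E w k beta -> is_E_form E k beta.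
Proof. by case. Qed.

Lemma dA0 : dA A (0 : forms M 'cV[R]_r) = 0.
Proof.
by have := dAB hA (E_form0 E 0) (E_form0 E 0); rewrite subr0 => ->; rewrite subrr.
Qed.

Lemma E_form_iter_lef j k f : is_E_form E k f -> is_E_form E (k + j.*2) (iter j (lef w) f).
Proof.
move=> hf; elim: j => [|j IH]; first by rewrite addn0.
by rewrite doubleS !addnS; exact: E_form_lef.
Qed.

Lemma dA_iter_lef j k f : is_E_form E k f -> dA A (iter j (lef w) f) = iter j (lef w) (dA A f).
Proof.
move=> hf; elim: j => //= j IH.
by rewrite (dA_lef hw hA (E_form_iter_lef j hf)) IH.
Qed.

Lemma act_EndB (P : forms M 'M[R]_r) f g : act_End P (f - g) = act_End P f - act_End P g.
Proof.
apply/funext => a; apply/funext => x; apply/funext => s.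
rewrite /act_End -[RHS]/(wedge mulmx (P a x) (f a x) s - wedge mulmx (P a x) (g a x) s).
rewrite -scaleN1r -(wedgeZr (@bilin_mulmx R r r 1)) -(wedgeDr (@bilin_mulmx R r r 1)).
by congr (wedge _ _ _ s); apply/funext => t; rewrite scaleN1r.
Qed.

Lemma act_End0 (P : forms M 'M[R]_r) : act_End P (0 : forms M 'cV[R]_r) = 0.
Proof. by have := act_EndB P 0 0; rewrite subrr => ->; rewrite subrr. Qed.

Lemma primitive_act_End (P : forms M 'M[R]_r) k beta : is_End_form E 0 P ->
  primitive E w k beta -> primitive E w k (act_End P beta).
Proof.
move=> hP [kn h h0]; split=> //; first exact: E_form_act_End.
have -> : forall j, iter j (lef w) (act_End P beta) = act_End P (iter j (lef w) beta).
  by elim=> // j IH; rewrite !iterS IH (lef_act_End _ _ hP).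
by rewrite h0 act_End0.
Qed.

(** As k < n, [L] is the first factor applied in L^(n-k), which is injective in degree k. *)
Lemma lef_inj_form k f : (k < n)%N -> is_E_form E k f -> lef w f = 0 -> f = 0.
Proof.
move=> kn hf h0; apply: (E_form_eq hf (E_form0 E k)) => a x ax.
apply: (lef_inj_at hw ax (ltnW kn) (form_alternating hf a x)).
by rewrite -iter_lefE -(subnSK kn) iterSr h0 iter_lef_forms0.
Qed.

(* For [k = n] the form [g0] would be primitive of degree [n + 1], and for
   [k = 0] the form [g1] of degree [-1]. *)
Definition lef_split k f g0 g1 :=
  [/\ (k < n)%N -> primitive E w k.+1 g0, k = n -> g0 = 0,
      k = 0%N -> g1 = 0, (0 < k)%N -> primitive E w k.-1 g1 & f = g0 + lef w g1].

Lemma lef_splitB k f g0 g1 f' g0' g1' : lef_split k f g0 g1 -> lef_split k f' g0' g1' ->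
  lef_split k (f - f') (g0 - g0') (g1 - g1').
Proof.
move=> [a1 a2 a3 a4 a5] [b1 b2 b3 b4 b5]; split.
- by move=> h; apply: primitiveB; [exact: a1|exact: b1].
- by move=> h; rewrite a2 // b2 // subr0.
- by move=> h; rewrite a3 // b3 // subr0.
- by move=> h; apply: primitiveB; [exact: a4|exact: b4].
- by rewrite a5 b5 lefD_forms lefN_forms opprD addrACA.
Qed.

Lemma lef_split_act_End (P : forms M 'M[R]_r) k f g0 g1 : is_End_form E 0 P ->
  lef_split k f g0 g1 -> lef_split k (act_End P f) (act_End P g0) (act_End P g1).
Proof.
move=> hP [a1 a2 a3 a4 a5]; split.
- by move=> h; apply: primitive_act_End => //; exact: a1.
- by move=> h; rewrite a2 // act_End0.
- by move=> h; rewrite a3 // act_End0.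
- by move=> h; apply: primitive_act_End => //; exact: a4.
- rewrite a5 -[lef w g1]opprK act_EndB (lef_act_End _ _ hP); congr (_ + _).
  by rewrite -[- lef w g1]add0r act_EndB act_End0 sub0r opprK.
Qed.

(** [dA] commutes with [L], so L^(n-k+1) kills [dA A beta] as it kills [beta], and the pointwise
    splitting applies. Its pieces are written with the operators [Lam] and [lef] on forms, hence are
    forms themselves. *)
Lemma lef_split_dA k beta : primitive E w k beta -> exists g0 g1,
  lef_split k (dA A beta) g0 g1.
Proof.
move=> [kn h h0]; have hd := E_form_dA hA h.
pose q : forms M 'cV[R]_r := fun a x s => (n - k).+1%:R^-1 *: Lam w (dA A beta) a x s.
have hq : is_E_form E k.-1 q by apply: E_formZ; exact: (E_form_Lam hw hd).
have dz a x : iter (n - k).+1 (lef_at (w a x)) (dA A beta a x) = 0.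
  by rewrite -iter_lefE -(dA_iter_lef _ h) h0 dA0.
have qE a x : q a x = lef_quot n (Lam_at (w a x)) k (dA A beta a x) by [].
have rE a x : (dA A beta - lef w q) a x
  = lef_rem n (lef_at (w a x)) (Lam_at (w a x)) k (dA A beta a x) by [].
have hal a x := form_alternating hd a x.
have q0 : k = 0%N -> q = 0.
  move=> k0; apply: (E_form_eq hq (E_form0 E _)) => a x ax; rewrite qE.
  exact: (lef_quot_deg0_at _ _ _ (hal a x) k0).
have hr : is_E_form E k.+1 (dA A beta - lef w q).
  (* For k = 0 the truncated degree [k.-1] is 0 and would give [lef w q] degree 2 instead of 1;
     there [q] is zero. *)
  apply: E_formB => //; have [k0|k0] := posnP k.
    by rewrite q0 // lef_forms0; exact: E_form0.
  by have := E_form_lef hw2 hq; rewrite prednK.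
exists (dA A beta - lef w q), q; split => //.
- move=> hk; apply: (primitive_intro hk hr) => a x ax; rewrite rE.
  exact: (lef_rem_prim_at hw ax kn (hal a x) (dz a x) hk).
- move=> hk; apply: (E_form_eq hr (E_form0 E _)) => a x ax; rewrite rE.
  exact: (lef_rem_top_at hw ax kn (hal a x) (dz a x) hk).
- move=> k0; apply: (primitive_intro _ hq) => [|a x ax]; first by lia.
  rewrite qE; exact: (lef_quot_prim_at hw ax kn (hal a x) (dz a x) k0).
- by rewrite subrK.
Qed.

(** Index 0 leaves the admissible range exactly when k = n, and index 1 exactly when k = 0: these
    are the cases where [lef_split] makes the corresponding piece vanish. *)
Lemma lef_split_lefschetz k f g0 g1 : (k <= n)%N -> lef_split k f g0 g1 ->
  lefschetz_decomposition E w k.+1 f (fun i => if i is j.+1 then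
    (if j is _.+1 then 0 else g1) else g0).
Proof.
move=> kn [a1 a2 a3 a4 a5]; split.
- move=> [|[|i]] hi.
  + by rewrite subn0; apply: a1; lia.
  + have k0 : (0 < k)%N by case/andP: hi => _; case: (k).
    by have := a4 k0; have -> : (k.+1 - 1.*2 = k.-1)%N by lia.
  + by apply: primitive0; lia.
- move=> [|[|i]] hi //.
  + apply: a2; lia.
  + apply: a3; move: hi; case: (k) kn => // k' kn; lia.
- rewrite big_ord_recl /= a5; congr (_ + _).
  case: k a3 {kn a1 a2 a4 a5} => [->//|k _].
    by rewrite big_ord0; exact: lef_forms0.
  rewrite /= big_ord_recl /= big1 ?addr0 // => i _.
  exact: (iter_lef_forms0 _ w i.+2).
Qed.

(** By uniqueness, exhibiting a splitting computes both operators; later evaluations of them rest on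
    this. *)
Lemma partialsE k beta g0 g1 : (k <= n)%N -> lef_split k (dA A beta) g0 g1 ->
  partial_plus E w A k beta = g0 /\ partial_minus E w A k beta = g1.
Proof.
move=> kn h; have hl := lefschetz_eq hw (lef_split_lefschetz kn h).
rewrite /partial_plus /partial_minus /prim_proj /lef_inv hl; split=> //.
case: k {kn hl} h => [|k] [_ _ h0 _ _]; first by rewrite big_geq // h0.
rewrite big_ltn // big_nat_cond big1 ?addr0 // => -[|[|i]] //= _.
exact: (iter_lef_forms0 _ w i.+1).
Qed.

Lemma partial_split k beta : primitive E w k beta ->
  lef_split k (dA A beta) (partial_plus E w A k beta) (partial_minus E w A k beta).
Proof.
move=> h; have kn : (k <= n)%N by case: h.
by have [g0 [g1 hs]] := lef_split_dA h; have [-> ->] := partialsE kn hs.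
Qed.

(** The operators go through a choice; their additivity is inherited from that of splittings. *)
Lemma partialsB k f g : primitive E w k f -> primitive E w k g ->
  partial_plus E w A k (f - g) = partial_plus E w A k f - partial_plus E w A k g /\
  partial_minus E w A k (f - g) = partial_minus E w A k f - partial_minus E w A k g.
Proof.
move=> hf hg; apply: partialsE; first by case: hf.
rewrite (dAB hA (primitive_form hf) (primitive_form hg)).
by apply: lef_splitB; exact: partial_split.
Qed.

Lemma partials0 k : (k <= n)%N ->
  partial_plus E w A k 0 = 0 /\ partial_minus E w A k 0 = 0.
Proof.
move=> kn; have := partialsB (primitive0 w E kn) (primitive0 w E kn).
by rewrite subrr => -[-> ->]; rewrite !subrr.
Qed.

Lemma primitive_partial_minus k beta : primitive E w k beta ->
  primitive E w k.-1 (partial_minus E w A k beta).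
Proof.
move=> h; have [_ _ h0 h1 _] := partial_split h; have [k0|/h1 //] := posnP k.
by rewrite h0 //; apply: primitive0; rewrite k0.
Qed.

Lemma partials_act_inv k beta : primitive E w k beta ->
  partial_plus E w A k (act_End Psi beta) = act_End Psi (partial_plus E w A k beta) /\
  partial_minus E w A k (act_End Psi beta) = act_End Psi (partial_minus E w A k beta).
Proof.
move=> h; apply: partialsE; first by case: h.
rewrite (dA_act_inv hA hflat hinv (primitive_form h)).
exact: lef_split_act_End (partial_split h).
Qed.

Lemma plus_exact k beta : (k < n)%N -> primitive E w k beta ->
  partial_plus E w A k beta = 0 ->
  if k is j.+1 then exists2 gamma, primitive E w j gamma & partial_plus E w A j gamma = beta
  else beta = 0.
Proof.
move=> kn h hp; have hf := primitive_form h.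
have [_ _ g0 g1 e] := partial_split h.
move: g0 g1 e; rewrite hp add0r; set g := partial_minus E w A k beta => g0 g1 e.
have e2 : act_End Phi (lef w beta) = dA A (lef w g).
  by rewrite -(dA_dA hw hA hflat hf) e.
have e3 : lef w beta = act_End Psi (dA A (lef w g)).
  by rewrite -e2 (act_End_invK hinv hPhi (E_form_lef hw2 hf)).
case: k kn h hp hf @g g0 g1 e e2 e3 => [|j] kn h hp hf g g0 g1 e e2 e3.
  (* In degree 0 the component [g] vanishes, so [lef w beta] is zero. *)
  by apply: (lef_inj_form kn hf); rewrite e3 g0 // lef_forms0 dA0 act_End0.
have hg := g1 isT; rewrite /= in hg.
exists (act_End Psi g); first exact: primitive_act_End.
have eb : beta = dA A (act_End Psi g).
  rewrite (dA_act_inv hA hflat hinv (primitive_form hg)).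
  have hE := E_form_act_End hPsi (E_form_dA hA (primitive_form hg)).
  apply/eqP; rewrite -subr_eq0; apply/eqP.
  apply: (lef_inj_form kn (E_formB hf hE)).
  rewrite lefD_forms lefN_forms e3 (dA_lef hw hA (primitive_form hg)).
  by rewrite (lef_act_End _ _ hPsi) subrr.
have jn : (j <= n)%N by lia.
(* The covariant derivative of the witness is [beta], already primitive, so the second piece of its
   splitting is 0. *)
apply: (partialsE jn (g1 := 0) _).1; split=> //.
- by lia.
- by move=> _; apply: primitive0; lia.
- by rewrite lef_forms0 addr0.
Qed.

(** The cocycle equation says that [Phi] times [beta] is partial_+ partial_- beta; [Psi] is applied
    to it and moved inside partial_+. *)
Lemma middle_exact beta : primitive E w n beta ->
  - partial_plus E w A n.-1 (partial_minus E w A n beta) + act_End Phi beta = 0 ->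
  beta = partial_plus E w A n.-1 (act_End Psi (partial_minus E w A n beta)).
Proof.
move=> h /eqP; rewrite addrC subr_eq0 => /eqP e.
rewrite (partials_act_inv (primitive_partial_minus h)).1 -e.
by rewrite (act_End_invK hinv hPhi (primitive_form h)).
Qed.

Lemma minus_top_exact beta : primitive E w n beta -> partial_minus E w A n beta = 0 ->
  - partial_plus E w A n.-1 (partial_minus E w A n (act_End Psi beta))
    + act_End Phi (act_End Psi beta) = beta.
Proof.
move=> h e; rewrite (partials_act_inv h).2 e act_End0 (partials0 (leq_pred n)).1.
by rewrite oppr0 add0r (act_End_inv hinv hPhi (primitive_form h)).
Qed.

Lemma minus_exact k beta : (k < n)%N -> primitive E w k beta ->
  partial_minus E w A k beta = 0 ->
  exists2 gamma, primitive E w k.+1 gamma & - partial_minus E w A k.+1 gamma = beta.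
Proof.
move=> kn h e; have hf := primitive_form h.
have [/(_ kn) hp _ _ _ ed] := partial_split h.
move: hp ed; rewrite e lef_forms0 addr0.
set g := partial_plus E w A k beta => hg ed.
have hPg := primitive_act_End hPsi hg.
(* Here [g] is the whole of d_A beta, so d_A (Psi g) = Psi Phi L beta = L beta: its primitive part
   is 0 and its quotient by [L] is [beta]. *)
have hs : lef_split k.+1 (dA A (act_End Psi g)) 0 beta.
  split=> //; first by move=> kn'; exact: primitive0.
  rewrite (dA_act_inv hA hflat hinv (primitive_form hg)) -ed (dA_dA hw hA hflat hf).
  by rewrite (act_End_invK hinv hPhi (E_form_lef hw2 hf)) add0r.
(* The negative is written as a difference because [partialsB] is stated for differences. *)
exists (0 - act_End Psi g); first by apply: primitiveB => //; exact: primitive0.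
rewrite (partialsB (primitive0 w E kn) hPg).2 (partials0 kn).2 (partialsE kn hs).2.
by rewrite sub0r opprK.
Qed.

Lemma prim_degree_le j : (j <= n.*2.+1)%N -> (prim_degree n j <= n)%N.
Proof. by move=> hj; rewrite /prim_degree; case: (leqP j n) => //; lia. Qed.

Lemma prim_diffB j f g : (j <= n.*2.+1)%N -> prim_space E w j f -> prim_space E w j g ->
  prim_diff E w A Phi j (f - g) = prim_diff E w A Phi j f - prim_diff E w A Phi j g.
Proof.
move=> hj; rewrite /prim_space /prim_diff /prim_degree /=.
case: ltngtP => [jn|jn|->] hf hg.
- exact: (partialsB hf hg).1.
- by rewrite (partialsB hf hg).2 opprB opprK addrC.
- rewrite (partialsB hf hg).2 act_EndB.
  rewrite (partialsB (primitive_partial_minus hf) (primitive_partial_minus hg)).1.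
  by rewrite !opprD addrACA.
Qed.

Lemma prim_cocyclesB j f g : (j <= n.*2.+1)%N -> prim_cocycles E w A Phi j f ->
  prim_cocycles E w A Phi j g -> prim_cocycles E w A Phi j (f - g).
Proof.
move=> hj [pf df] [pg dg]; split; first exact: primitiveB.
by rewrite prim_diffB // df dg subr0.
Qed.

Lemma prim_cocycles0 j : (j <= n.*2.+1)%N -> prim_cocycles E w A Phi j 0.
Proof.
move=> hj; have p0 : prim_space E w j 0 by exact/primitive0/prim_degree_le.
by split=> //; have := prim_diffB hj p0 p0; rewrite subrr => ->; rewrite subrr.
Qed.

(** Differences of cocycles are cocycles, so if these are all coboundaries every class is the full
    set of cocycles. The cocycle 0 shows that a class exists. *)
Lemma prim_cohomology_trivial j : (j <= n.*2.+1)%N ->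
  prim_cocycles E w A Phi j `<=` prim_coboundaries E w A Phi j ->
  prim_cohomology E w A Phi j = [set prim_class E w A Phi j 0].
Proof.
move=> hj sub.
have cl f : prim_cocycles E w A Phi j f ->
    prim_class E w A Phi j f = prim_cocycles E w A Phi j.
  move=> hf; apply/seteqP; split=> [g []//|g hg]; split=> //.
  by apply: sub; exact: prim_cocyclesB.
have c0 := prim_cocycles0 hj.
apply/seteqP; split=> [_ [f hf <-]|_ ->] /=; first by rewrite !cl.
by exists 0.
Qed.

Lemma cocycles_coboundaries_plus k : (k <= n)%N ->
  prim_cocycles E w A Phi k `<=` prim_coboundaries E w A Phi k.
Proof.
move=> kn beta [hs hd].
have h : primitive E w k beta by move: hs; rewrite /prim_space /prim_degree /= kn.
have [kn'|nk] := ltnP k n.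
  move: hd; rewrite /prim_diff kn' => /(plus_exact kn' h).
  case: k kn kn' {hs h} => [|j] kn kn'; first by move=> ->.
  move=> [gamma hg <-]; exists gamma.
    by rewrite /prim_space /prim_degree /= (ltnW kn).
  by rewrite /prim_diff kn.
have ek : k = n by lia.
rewrite ek in h; rewrite /prim_diff ltnNge nk /= ek eqxx in hd; have eb := middle_exact h hd.
have [_ _ h0 _ _] := partial_split h.
case: k ek {hs kn nk} => [|j] ek.
  (* For n = 0 the middle term is also the first one and has no incoming map; partial_- vanishes in
     degree 0, which forces [beta] to be 0. *)
  by rewrite /= eb (h0 (esym ek)) act_End0 (partials0 (leq_pred n)).1.
have hm := primitive_act_End hPsi (primitive_partial_minus h).
have ej : n.-1 = j by rewrite -ek.
exists (act_End Psi (partial_minus E w A n beta)).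
  have jn : (j <= n)%N by lia.
  by rewrite /prim_space /prim_degree /= jn -ej.
have jn : (j < n)%N by lia.
by rewrite /prim_diff jn [RHS]eb ej.
Qed.

Lemma cocycles_coboundaries_minus k : (k <= n)%N ->
  prim_cocycles E w A Phi (n.*2.+1 - k) `<=` prim_coboundaries E w A Phi (n.*2.+1 - k).
Proof.
move=> kn beta [].
have dk l : (l <= n)%N -> prim_degree n (n.*2.+1 - l) = l.
  by move=> ln; rewrite /prim_degree; case: (leqP _ n); lia.
have Dl l : (l <= n)%N -> prim_diff E w A Phi (n.*2.+1 - l) = fun f => - partial_minus E w A l f.
  by move=> ln; rewrite /prim_diff dk //; case: ltngtP => //; lia.
rewrite /prim_space /= dk // Dl // => h /eqP; rewrite oppr_eq0 => /eqP hd.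
(* The preceding term has number 2n - k: it is P^(k+1)_- when k < n, and P^n_+, the source of the
   middle map, when k = n. *)
have -> : (n.*2.+1 - k = (n.*2 - k).+1)%N by lia.
have [kn'|nk] := ltnP k n.
  have [gamma hg e] := minus_exact kn' h hd; exists gamma.
    by rewrite /prim_space /= -subSS dk.
  by rewrite -subSS Dl.
have ek : k = n by lia.
rewrite ek in h hd *; have -> : (n.*2 - n = n)%N by lia.
exists (act_End Psi beta).
  by rewrite /prim_space /prim_degree /= leqnn; exact: primitive_act_End.
by rewrite /prim_diff ltnn eqxx; exact: minus_top_exact.
Qed.

End complex.

Theorem theorem4p2 (R : realType) (n r : nat) (M : manifold R n.*2)
    (w : forms M R) (E : vector_bundle M r) (A Phi : forms M 'M[R]_r)
    (hw : symplectic w) (hA : is_connection E A)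
    (hflat : symplectically_flat E w A Phi) (hinv : invertible Phi) :
  forall k : nat, (k <= n)%N ->
    PH_plus E w A Phi k = [set prim_class E w A Phi k 0]
    /\ PH_minus E w A Phi k = [set prim_class E w A Phi (n.*2.+1 - k) 0].
Proof.
move=> k kn; split; apply: prim_cohomology_trivial => //.
- by lia.
- exact: cocycles_coboundaries_plus.
- exact: leq_subr.
- exact: cocycles_coboundaries_minus.
Qed.
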